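(* Let $d\ge1$ and let $S_N=\sum_{n=1}^N X_n$ be a random walk on $\mathbb{Z}^d$ with i.i.d. steps satisfying the non-degeneracy and aperiodicity assumptions of the context. Suppose that $S_N$ is in the normal domain of attraction of a stable law of some index $\alpha$, and that one of the following holds: (a) $\alpha>1$ and $\mathbb{E}(X_1)=0$; or (b) $\alpha<1$. Then there exists $F\in\mathbf{G}_0$ such that, with $T_N=\sum_{n=1}^NF(S_n)$, with probability $1$ the sequence $\frac{T_N}{N}$ does not converge as $N\to\infty$.
   Context: $X_1,X_2,\dots$ are i.i.d. $\mathbb{Z}^d$-valued random variables, $S_0=0$, $S_N=\sum_{n=1}^N X_n$. Standing assumptions: (non-degeneracy) the smallest group supporting the range of $X_1$ is $\mathbb{Z}^d$; (aperiodicity) $\gcd\{n>0:\mathbb{P}(S_n=0)>0\}=1$. $S_n$ is in the normal domain of attraction of a stable law of index $\alpha$ if there is a non-degenerate $d$-dimensional random variable $Y$ (i.e. not supported in a proper affine subspace), with $\alpha$-stable law, such that $\frac{S_n}{n^{1/\alpha}}\Rightarrow Y$ if $\alpha\in(0,1)$, and $\frac{S_n-n\mathbb{E}(X_1)}{n^{1/\alpha}}\Rightarrow Y$ if $\alpha\in(1,2]$ (convergence in law). For a non-empty finite $V\subset\mathbb{Z}^d$ and a bounded $F:\mathbb{Z}^d\to\mathbb{R}$, $\bar F_V=\frac1{|V|}\sum_{v\in V}F(v)$. For real $a_j<b_j$, $V(a_1,b_1,\dots,a_d,b_d)=\{x\in\mathbb{Z}^d: x_j\in[a_j,b_j],\ j=1,\dots,d\}$.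 $\mathbf{G}_0$ is the set of bounded $F:\mathbb{Z}^d\to\mathbb{R}$ for which there is a number $\bar F$ such that for all $a_1<b_1,\dots,a_d<b_d$, $\lim_{L\to\infty}\bar F_{V(a_1L,b_1L,\dots,a_dL,b_dL)}=\bar F$. *)

(* Defs.v *)
From HB Require Import structures.
From mathcomp Require Import all_boot all_order all_algebra finmap.
From mathcomp Require Import all_classical all_reals all_analysis.

Set Implicit Arguments.
Unset Strict Implicit.
Unset Printing Implicit Defensive.

Import Order.TTheory GRing.Theory Num.Theory.
Import numFieldNormedType.Exports.

Local Open Scope classical_set_scope.
Local Open Scope ring_scope.

(* R^d with its Borel sigma-algebra. *)
Definition borel_vec (R : realType) (d : nat) :=
  g_sigma_algebraType (@open 'rV[R]_d).

Definition embed (R : realType) (d : nat) (x : 'rV[int]_d) : 'rV[R]_d :=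
  \row_j (x 0 j)%:~R.

(* Steps are indexed from 0: X n stands for the (n+1)-st step. *)
Definition walk (T : Type) (d : nat) (X : nat -> T -> 'rV[int]_d)
    (n : nat) (w : T) : 'rV[int]_d :=
  \sum_(k < n) X k w.

Section RandomWalk.
Context (R : realType) (disp : measure_display) (T : measurableType disp).
Context (P : probability T R) (d : nat).
Implicit Type X : nat -> T -> 'rV[int]_d.

(* Z^d carries the discrete sigma-algebra. *)
Definition discrete_measurable (Z : T -> 'rV[int]_d) :=
  forall A : set 'rV[int]_d, measurable (Z @^-1` A).

Definition mutually_independent X :=
  forall (J : seq nat) (A : nat -> set 'rV[int]_d), uniq J ->
    P (\bigcap_(j in [set` J]) (X j @^-1` A j)) =
    (\prod_(j <- J) P (X j @^-1` A j))%E.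

Definition identically_distributed X :=
  forall (n : nat) (A : set 'rV[int]_d), P (X n @^-1` A) = P (X 0%N @^-1` A).

Definition iid X :=
  [/\ forall n, discrete_measurable (X n),
      mutually_independent X & identically_distributed X].

Definition nondegenerate_walk X :=
  forall H : {pred 'rV[int]_d}, GRing.zmod_closed H ->
    P [set w | X 0%N w \in H] = 1%E -> forall x, x \in H.

Definition is_gcd (A : set nat) (g : nat) :=
  (forall n, A n -> (g %| n)%N) /\
  (forall h : nat, (forall n, A n -> (h %| n)%N) -> (h %| g)%N).

Definition aperiodic_walk X :=
  is_gcd [set n | (0 < n)%N /\ (0 < P [set w | walk X n w = 0%R])%E] 1%N.

Definition integrable_vec (Z : T -> 'rV[int]_d) :=
  forall j, P.-integrable setT (EFin \o (fun w => (Z w 0 j)%:~R : R)).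

Definition mean_vec (Z : T -> 'rV[int]_d) : 'rV[R]_d :=
  \row_j fine 'E_P[fun w => (Z w 0 j)%:~R : R].

Definition cvg_in_law (Z : nat -> T -> 'rV[R]_d)
    (mu : probability (borel_vec R d) R) :=
  forall f : 'rV[R]_d -> R, continuous f -> bounded_fun f ->
    (fun n => \int[P]_w (f (Z n w))%:E)%E @ \oo -->
      (\int[mu]_y (f y)%:E)%E.

End RandomWalk.

Section StableLaws.
Context (R : realType) (d : nat).
Implicit Type mu : probability (borel_vec R d) R.

(* A proper affine subspace is a + (row space of W) with W of rank < d. *)
Definition nondegenerate_law mu :=
  forall (a : 'rV[R]_d) (W : 'M[R]_d), (\rank W < d)%N ->
    mu [set y : 'rV[R]_d | (y - a <= W)%MS] != 1%E.

(* If Y, Y1, Y2 are independent with law mu, then a Y1 + b Y2 has the law of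
   (a^alpha + b^alpha)^(1/alpha) Y + v for some vector v. *)
Definition stable_law (alpha : R) mu :=
  0 < alpha <= 2 /\
  forall a b : R, 0 < a -> 0 < b -> exists v : 'rV[R]_d,
    forall U : set (borel_vec R d), measurable U ->
      (mu \x mu)%E
        [set y | U (a *: (y.1 : 'rV[R]_d) + b *: (y.2 : 'rV[R]_d))] =
      mu [set y | U
        ((a `^ alpha + b `^ alpha) `^ alpha^-1 *: (y : 'rV[R]_d) + v)].

End StableLaws.

Definition normal_domain_of_attraction (R : realType)
    (disp : measure_display) (T : measurableType disp) (P : probability T R)
    (d : nat) (X : nat -> T -> 'rV[int]_d) (alpha : R) :=
  exists mu : probability (borel_vec R d) R,
    [/\ stable_law alpha mu, nondegenerate_law mu &
      (0 < alpha < 1 /\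
       cvg_in_law P
         (fun n w => (n%:R `^ alpha^-1)^-1 *: embed R (walk X n w)) mu) \/
      [/\ 1 < alpha <= 2, integrable_vec P (X 0%N) &
       cvg_in_law P
         (fun n w => (n%:R `^ alpha^-1)^-1 *:
            (embed R (walk X n w) - n%:R *: mean_vec P (X 0%N))) mu]].

Section Averages.
Context (R : realType) (d : nat).

Definition average (F : 'rV[int]_d -> R) (V : set 'rV[int]_d) : R :=
  #|` fset_set V|%:R^-1 * \sum_(x \in V) F x.

Definition box (a b : 'I_d -> R) : set 'rV[int]_d :=
  [set x | forall j, a j <= (x 0 j)%:~R <= b j].

(* fset_set, hence average, is only meaningful on finite sets. *)
Lemma finite_box (a b : 'I_d -> R) : finite_set (box a b).
Proof.
pose B : R := \sum_(j < d) (`|a j| + `|b j|).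
pose n := (Num.truncn B).+1.
pose f (x : {ffun 'I_d -> 'I_n * bool}) : 'rV[int]_d :=
  \row_j (if (x j).2 then - ((x j).1 : nat)%:Z else ((x j).1 : nat)%:Z).
apply: (@sub_finite_set _ _ (f @` setT)); last first.
  by apply: finite_image; exact: finite_finset.
move=> x xab.
have xn j : (absz (x ord0 j) < n)%N.
  have /andP[ax xb] := xab j.
  have xB : (absz (x ord0 j))%:R <= B.
    rewrite -[_%:R]/((absz (x ord0 j))%:Z%:~R) abszE intr_norm.
    apply: (@le_trans _ _ (`|a j| + `|b j|)).
      rewrite ler_norml; apply/andP; split.
        rewrite (le_trans _ ax)// lerNl (le_trans (ler_norm _))// normrN.
        by rewrite lerDl.
      by rewrite (le_trans xb)// (le_trans (ler_norm _))// lerDr.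
    rewrite /B (bigD1 j)//= lerDl; apply: sumr_ge0 => k _.
    exact: addr_ge0.
  by rewrite -(ltr_nat R) (le_lt_trans xB)// truncnS_gt.
exists [ffun j => (Ordinal (xn j), x ord0 j < 0)] => //.
apply/rowP => j; rewrite mxE ffunE /= abszE.
by case: ltP => x0; [rewrite ltr0_norm// opprK|rewrite ger0_norm].
Qed.

(* L tends to infinity along the reals. *)
Definition G0 (F : 'rV[int]_d -> R) :=
  bounded_fun F /\
  exists Fbar : R, forall a b : 'I_d -> R, (forall j, a j < b j) ->
    average F (box (fun j => a j * L) (fun j => b j * L)) @[L --> +oo]
      --> Fbar.

End Averages.

Definition additive_functional (R : realType) (T : Type) (d : nat)
    (X : nat -> T -> 'rV[int]_d) (F : 'rV[int]_d -> R) (N : nat) (w : T) : R :=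
  \sum_(1 <= n < N.+1) F (walk X n w).

(* Main.v *)
(** F only depends on the first coordinate z of the site: F = 1 when z
   lies in one of the intervals J_k = [x_k - 2 e_k |x_k|, x_k + 2 e_k |x_k|]
   with k even, and F = 0 otherwise.  If e_k tends to 0 and |x_k| grows fast
   enough, the marked set has density 0 at every macroscopic scale, so F is in
   G_0.  On the other hand, for every e > 0 there is p(e) > 0 such that, for
   arbitrarily large n, with probability at least p(e) the walk stays within
   distance e |x| of some x of order n^(1/alpha) during the whole time interval
   [n/4, n]: it first goes to x, and then moves by at most a small multiple of
   n^(1/alpha).  If e_k tends to 0 slowly enough for the sum of the p(e_k) over
   each parity class to diverge, then almost surely this happens near x_k for
   infinitely many even k and infinitely many odd k, by independence of
   the increments over disjoint time intervals.  Then T_N/N is at least 2/3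
   infinitely often and at most 3/8 infinitely often.

   The stable limit only enters through tightness of |S_n| / n^(1/alpha) and
   the fact that it does not tend to 0 in probability. *)

Require Import Defs.
From HB Require Import structures.
From mathcomp Require Import all_boot all_order all_algebra finmap.
From mathcomp Require Import all_classical all_reals all_analysis.
From mathcomp Require Import measurable_realfun ring lra zify.

Set Implicit Arguments.
Unset Strict Implicit.
Unset Printing Implicit Defensive.

Import Order.TTheory GRing.Theory Num.Theory.
Import numFieldNormedType.Exports.

Local Open Scope classical_set_scope.
Local Open Scope ring_scope.

(** * Laws of random walks on cylinder sets *)


Definition psum (R : realType) (y : nat -> int) (n : nat) : R :=
  (\sum_(i < n) y i)%:~R.

(** Paths are coded by their increments, so the shifted path is the walk restarted from the origin
    at time [t]. *)
Definition shift (t : nat) (y : nat -> int) : nat -> int :=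
  fun i => y (t + i)%N.

(** Increments being integers, such a set is a countable union of events that prescribe the first
    [n] increments; this is why [G] carries no measurability assumption. *)
Definition cylinder (n : nat) (G : set (nat -> int)) :=
  forall y y', (forall i, (i < n)%N -> y i = y' i) -> G y -> G y'.

Section Cylinders.
Context (R : realType).
Implicit Types (G H : set (nat -> int)) (y : nat -> int).

Lemma psum0 y : psum R y 0 = 0.
Proof. by rewrite /psum big_ord0. Qed.

Lemma psum_eq n j y y' : (forall i, (i < n)%N -> y i = y' i) -> (j <= n)%N ->
  psum R y j = psum R y' j.
Proof.
move=> e jn; rewrite /psum; congr (_%:~R); apply: eq_bigr => i _.
by apply: e; apply: leq_trans jn.
Qed.

Lemma psum_shift t y j : psum R (shift t y) j = psum R y (t + j) - psum R y t.
Proof.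
by rewrite /psum big_split_ord /= rmorphD/= addrC addKr.
Qed.

Lemma cylinderT n : cylinder n setT. Proof. by []. Qed.

Lemma cylinderC n G : cylinder n G -> cylinder n (~` G).
Proof. by move=> cG y y' e nG Gy; apply: nG; apply: cG Gy => i /e. Qed.

Lemma cylinderI n G H : cylinder n G -> cylinder n H -> cylinder n (G `&` H).
Proof. by move=> cG cH y y' e [Gy Hy]; split; [apply: cG Gy|apply: cH Hy]. Qed.

Lemma cylinderU n G H : cylinder n G -> cylinder n H -> cylinder n (G `|` H).
Proof.
by move=> cG cH y y' e [Gy|Hy]; [left; apply: cG Gy|right; apply: cH Hy].
Qed.

Lemma cylinder_bigcup n (I : Type) (D : set I) (G : I -> set (nat -> int)) :
  (forall i, D i -> cylinder n (G i)) -> cylinder n (\bigcup_(i in D) G i).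
Proof. by move=> cG y y' e [i Di Gy]; exists i => //; exact: cG Gy. Qed.

Lemma cylinder_le m n G : (m <= n)%N -> cylinder m G -> cylinder n G.
Proof. by move=> mn cG y y' e; apply: cG => i im; apply: e; exact: leq_trans mn. Qed.

Lemma cylinder_shift t n G : cylinder n G -> cylinder (t + n) (shift t @^-1` G).
Proof.
by move=> cG y y' e; apply: cG => i im; apply: e; rewrite ltn_add2l.
Qed.

Lemma cylinder_psum n j (Q : R -> Prop) : (j <= n)%N ->
  cylinder n [set y | Q (psum R y j)].
Proof. by move=> jn y y' e /=; rewrite (psum_eq e jn). Qed.

Lemma cylinder_psums n (D : nat -> Prop) (Q : nat -> R -> Prop) :
  (forall j, D j -> (j <= n)%N) ->
  cylinder n [set y | forall j, D j -> Q j (psum R y j)].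
Proof. by move=> Dn y y' e h j Dj; rewrite -(psum_eq e (Dn _ Dj)); exact: h. Qed.

End Cylinders.

(* Finite additivity on cylinders and the Markov property are all that the
   estimates below need from the law of the increments. *)
Record walk_law (R : realType) (m : set (nat -> int) -> R) : Prop := WalkLaw {
  law_ge0 : forall G, 0 <= m G;
  law_setT : m setT = 1;
  law_setU : forall n G H, cylinder n G -> cylinder n H ->
    G `&` H = set0 -> m (G `|` H) = m G + m H;
  law_markov : forall t n G H, cylinder t G -> cylinder n H ->
    m (G `&` shift t @^-1` H) = m G * m H }.

Section WalkLaws.
Context (R : realType) (m : set (nat -> int) -> R) (mP : walk_law m).
Implicit Types (G H : set (nat -> int)) (y : nat -> int).
Local Notation S := (psum R).

Lemma law_split n G H : cylinder n G -> cylinder n H ->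
  m G = m (G `&` H) + m (G `&` ~` H).
Proof.
move=> cG cH; rewrite -(law_setU mP (n := n)).
- by rewrite -setIUr setUCr setIT.
- exact: cylinderI.
- by apply: cylinderI => //; exact: cylinderC.
- by rewrite setIACA setICr setI0.
Qed.

Lemma law_le n G H : cylinder n G -> cylinder n H -> G `<=` H -> m G <= m H.
Proof.
move=> cG cH GH; rewrite (law_split cH cG) setIC (setIidl GH) lerDl.
exact: law_ge0.
Qed.

Lemma law_setC n G : cylinder n G -> m (~` G) = 1 - m G.
Proof.
move=> cG; rewrite -(law_setT mP) (law_split (@cylinderT n) cG) !setTI.
by rewrite addrC addKr.
Qed.

Lemma law_le1 n G : cylinder n G -> m G <= 1.
Proof. by move=> cG; rewrite -(law_setT mP); exact: law_le cG (@cylinderT n) _. Qed.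

Lemma law_leU n G H : cylinder n G -> cylinder n H ->
  m (G `|` H) <= m G + m H.
Proof.
move=> cG cH; rewrite (law_split (cylinderU cG cH) cG) (setIidr (@subsetUl _ G H)) lerD2l.
apply: (@law_le n) => //.
  by apply: cylinderI; [exact: cylinderU|exact: cylinderC].
by move=> y [[]].
Qed.

Lemma law_bigcup n K (G : nat -> set (nat -> int)) :
  (forall i, (i < K)%N -> cylinder n (G i)) ->
  m (\bigcup_(i in [set i | (i < K)%N]) G i) <= \sum_(i < K) m (G i).
Proof.
elim: K => [|K ih] cG.
  rewrite big_ord0 (_ : \bigcup_(i in _) _ = set0); last first.
    by rewrite -subset0 => y [].
  by rewrite -setCT (law_setC (@cylinderT 0)) (law_setT mP) subrr.
rewrite big_ord_recr/=.
have e : \bigcup_(i in [set i | (i < K.+1)%N]) G i =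
    (\bigcup_(i in [set i | (i < K)%N]) G i) `|` G K.
  apply/seteqP; split => y.
    move=> [i /=]; rewrite ltnS leq_eqVlt => /predU1P[->|iK] Gy; first by right.
    by left; exists i.
  by move=> [[i /= iK Gy]|Gy]; [exists i => //=; exact: ltnW|exists K => /=].
have cG' i : (i < K)%N -> cylinder n (G i) by move=> iK; apply: cG; exact: ltnW.
rewrite e (le_trans (law_leU (n := n) _ _))//; last by rewrite lerD2r ih.
- exact: cylinder_bigcup.
- exact: cG.
Qed.

(* Markov's inequality for the number of events that occur, by induction on K
   with D split according to whether the last event occurs. *)
Lemma law_count n (C : nat -> set (nat -> int)) K c D :
  (forall i, (i < K)%N -> cylinder n (C i)) -> cylinder n D ->
  \sum_(i < K) m (C i `&` D) <= c%:R * m D +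
    K%:R * m (D `&` [set y | (c < \sum_(i < K) `[< C i y >])%N]).
Proof.
elim: K c D => [|K ih] c D cC' cD.
  by rewrite big_ord0 mul0r addr0 mulr_ge0 // law_ge0.
have {}ih c' D' : cylinder n D' -> _ := ih c' D' (fun i iK => cC' i (ltnW iK)).
have cC : forall i : 'I_K.+1, cylinder n (C i) by move=> i; exact: cC'.
have cCK : cylinder n (C K) by exact: cC'.
have ccount c' k : (k <= K.+1)%N ->
    cylinder n [set y | (c' < \sum_(i < k) `[< C i y >])%N].
  move=> kK y y' e /=.
  rewrite (eq_bigr (fun i : 'I_k => nat_of_bool `[< C i y' >]))// => i _.
  have iK : (i < K.+1)%N by exact: leq_trans kK.
  by congr nat_of_bool; apply/asboolP/asboolP; apply: (cC' i iK) => // j /e.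
rewrite big_ord_recr/=; case: c => [|c].
  rewrite mul0r add0r.
  (* For [c = 0], a single occurrence already makes the count positive, so each of the [K + 1] terms
     is at most the last probability. *)
  have h i : (i < K.+1)%N -> m (C i `&` D) <=
      m (D `&` [set y | (0 < \sum_(i < K.+1) `[< C i y >])%N]).
    move=> iK; apply: (@law_le n); [by apply: cylinderI; first exact: cC'| |].
      by apply: cylinderI => //; exact: ccount.
    move=> y [Cy Dy]; split => //=.
    by rewrite (bigD1 (Ordinal iK))//= asboolT.
  rewrite -natr1 mulrDl mul1r lerD ?h//.
  rewrite mulr_natl -[X in _ *+ X](card_ord K) -sumr_const ler_sum// => i _.
  by apply: h; exact: ltnW (ltn_ord i).
have -> : \sum_(i < K) m (C i `&` D) =
   \sum_(i < K) m (C i `&` (D `&` C K)) + \sum_(i < K) m (C i `&` (D `&` ~` C K)).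
  rewrite -big_split/=; apply: eq_bigr => i _.
  by rewrite (law_split (H := C K) (cylinderI (cC' i (ltnW (ltn_ord i))) cD) cCK) !setIA.
have cDK := cylinderI cD cCK.
have cDK' := cylinderI cD (cylinderC cCK).
(* On [C K] the other [K] events only have to exceed [c]; off [C K] they have to exceed [c.+1]. The
   remaining term [m (C K & D)] lifts the coefficient of [m (D & C K)] from [c] to [c + 1]. *)
have /lerD := ih c _ cDK => /(_ _ _ (ih c.+1 _ cDK')) ihc.
set Z := [set y | (c.+1 < \sum_(i < K.+1) _)%N].
have cDZ : cylinder n (D `&` Z) by apply: cylinderI => //; exact: ccount.
have -> : m D = m (D `&` C K) + m (D `&` ~` C K) by exact: law_split cD cCK.
have eZ : m (D `&` Z) = m (D `&` Z `&` C K) + m (D `&` Z `&` ~` C K).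
  exact: law_split cDZ cCK.
have e1 : m (D `&` C K `&` [set y | (c < \sum_(i < K) `[< C i y >])%N]) <=
   m (D `&` Z `&` C K).
  apply: (@law_le n); [by apply: cylinderI => //; exact: ccount|exact: cylinderI|].
  move=> y [[Dy CKy] /= cy]; split => //; split => //.
  by rewrite /Z/= big_ord_recr/= asboolT// addn1 ltnS.
have e2 : m (D `&` ~` C K `&` [set y | (c.+1 < \sum_(i < K) `[< C i y >])%N]) <=
   m (D `&` Z `&` ~` C K).
  apply: (@law_le n); [by apply: cylinderI => //; exact: ccount| |].
    by apply: cylinderI => //; exact: cylinderC.
  move=> y [[Dy CKy] /= cy]; split => //; split => //.
  by rewrite /Z/= big_ord_recr/= asboolF// addn0.
apply: le_trans (lerD ihc (lexx _)) _.
have K0 : 0 <= K%:R :> R by [].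
have := ler_wpM2l K0 e1; have := ler_wpM2l K0 e2.
have : 0 <= m (D `&` Z) by exact: law_ge0.
rewrite (setIC (C K) D) eZ -!natr1; nra.
Qed.

End WalkLaws.

(** * Maximal inequality and pigeonhole *)


Section SmallDeviations.
Context (R : realType) (m : set (nat -> int) -> R) (mP : walk_law m).
Implicit Types (G H : set (nat -> int)) (y : nat -> int).
Local Notation S := (psum R).

Lemma law_set0 : m set0 = 0.
Proof. by rewrite -setCT (law_setC mP (@cylinderT 0)) (law_setT mP) subrr. Qed.

(* Ottaviani's inequality, by decomposing along the first passage above [2x]. *)
Lemma law_max n x eta : (forall j, (j <= n)%N -> m [set y | x < `|S y j|] <= eta) ->
  (1 - eta) * m [set y | exists2 j, (j <= n)%N & 2 * x < `|S y j|] <= eta.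
Proof.
move=> xeta.
pose M k := [set y | exists2 j, (j < k)%N & 2 * x < `|S y j|].
pose B := [set y | x < `|S y n|].
have cM k l : (k <= l.+1)%N -> cylinder l (M k).
  move=> kn y y' e [j jk]; rewrite (psum_eq R e) => [xj|]; first by exists j.
  by rewrite -ltnS (leq_trans jk).
have cB : cylinder n B by exact: (@cylinder_psum _ _ _ (fun s => x < `|s|)).
suff claim k : (k <= n.+1)%N -> (1 - eta) * m (M k) <= m (M k `&` B).
  apply: (le_trans (claim n.+1 (leqnn _))); apply: le_trans (xeta n (leqnn _)).
  apply: (law_le mP _ cB) => [|y []//].
  by apply: cylinderI cB; exact: cM.
elim: k => [|k ih] kn.
  rewrite (_ : M 0%N = set0) ?set0I ?law_set0 ?mulr0//.
  by rewrite -subset0 => y [].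
(* The first passage above [2 * x] happens exactly at time [k]. *)
pose E := ~` M k `&` [set y | 2 * x < `|S y k|].
have cE : cylinder k E.
  apply: cylinderI; first by apply: cylinderC; exact: cM.
  exact: (@cylinder_psum _ _ _ (fun s => 2 * x < `|s|)).
have ME : M k.+1 = M k `|` E.
  apply/seteqP; split => y.
    move=> [j]; rewrite ltnS leq_eqVlt => /predU1P[->|jk] xj; last by left; exists j.
    by have [|nM] := pselect (M k y); [left|right].
  by move=> [[j jk xj]|[_ xk]]; [exists j => //; exact: ltnW|exists k].
have cMn : cylinder n (M k) by apply: cM; exact: ltnW.
have cEn : cylinder n E by exact: cylinder_le cE.
have MED : M k `&` E = set0 by rewrite /E setIA setICr set0I.
rewrite ME setIUl !(law_setU mP (n := n))//.
- rewrite mulrDr lerD ?ih ?(ltnW kn)//.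
  (* After a passage at time [k], an increment of modulus at most [x] over the remaining time leaves
     the walk beyond [x] at time [n]. That increment is independent of [E]. *)
  pose H := [set y | ~ (x < `|S y (n - k)|)].
  have cH : cylinder (n - k) H.
    exact: (@cylinder_psum _ _ _ (fun s => ~ (x < `|s|))).
  apply: (@le_trans _ _ (m (E `&` shift k @^-1` H))).
    rewrite (law_markov mP cE cH) mulrC ler_wpM2l ?(law_ge0 mP)//.
    have -> : H = ~` [set y | x < `|S y (n - k)|] by [].
    rewrite (law_setC mP (n := n)); last exact: (@cylinder_psum _ _ _ (fun s => x < `|s|)) (leq_subr _ _).
    by rewrite lerD2l lerN2 xeta ?leq_subr.
  have knE : (k + (n - k))%N = n by rewrite subnKC.
  apply: (law_le mP (n := n)).
  + by apply: cylinderI => //; have := cylinder_shift (t := k) cH; rewrite knE.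
  + exact: cylinderI.
  + move=> y [[nM xk]] /= /negP; rewrite -leNgt psum_shift knE => xn; split => //=.
    have := ler_normB (S y n) (S y n - S y k).
    rewrite opprB addrCA subrr addr0 => h.
    by rewrite /B/=; have := lt_le_trans xk h; lra.
- by apply: cylinderI.
- by apply: cylinderI.
- by rewrite setIACA MED set0I.
Qed.

(* [del < |s| / r <= A] is covered by 2N intervals of half-width eps. *)
Lemma law_pigeonhole n (r del A eps : R) (N : nat) :
  0 < r -> 0 < del -> 0 < eps -> A <= N%:R * eps ->
  exists c : R, del <= `|c| /\
    m [set y | del * r < `|S y n| /\ `|S y n| <= A * r] <=
    (2 * N%:R + 1) * m [set y | `|S y n - c * r| <= eps * r].
Proof.
move=> r0 del0 eps0 AN; apply: contrapT => /forallNP noc.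
set p := m [set y | _] in noc.
pose V c := [set y | `|S y n - c * r| <= eps * r].
have cV c : cylinder n (V c).
  exact: (@cylinder_psum _ _ _ (fun s => `|s - c * r| <= eps * r)).
have Vp (c : R) : del <= `|c| -> (2 * N%:R + 1) * m (V c) < p.
  by move=> dc; rewrite ltNge; apply/negP => h; exact: (noc c).
pose c i : R := del + i%:R * eps.
have c0 i : 0 <= i%:R * eps :> R by rewrite mulr_ge0// ltW.
have dc i : del <= `|c i| by rewrite ger0_norm /c ?lerDl// addr_ge0// ltW.
have cover : [set y | del * r < `|S y n| /\ `|S y n| <= A * r] `<=`
    \bigcup_(i in [set i | (i < N)%N]) V (c i) `|`
    \bigcup_(i in [set i | (i < N)%N]) V (- c i).
  move=> y /= [sdel sA].
  (* The normalised modulus measured from [del] in units of [eps]; its integer part selects the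
     covering interval, and the sign of the walk selects the family. *)
  pose t : R := (`|S y n| / r - del) / eps.
  have t0 : 0 <= t.
    by rewrite divr_ge0 ?(ltW eps0)// subr_ge0 ler_pdivlMr// ltW.
  have et : `|S y n| = (del + t * eps) * r.
    by rewrite /t; field; rewrite !gt_eqF.
  have /andP[t1 t2] := truncn_itv t0.
  set i := Num.truncn t in t1 t2.
  have iN : (i < N)%N.
    rewrite -(ltr_nat R) (le_lt_trans t1)// -(ltr_pM2r eps0) (lt_le_trans _ AN)//.
    rewrite -(ltr_pM2r r0); apply: lt_le_trans sA; rewrite et.
    by rewrite ltr_pM2r//; lra.
  have sc : `| `|S y n| - c i * r| <= eps * r.
    rewrite et /c -mulrBl normrM (gtr0_norm r0) ler_pM2r//.
    rewrite -natr1 in t2.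
    have -> : del + t * eps - (del + i%:R * eps) = (t - i%:R) * eps by ring.
    rewrite ger0_norm ?mulr_ge0 ?subr_ge0// ?(ltW eps0)//.
    by rewrite -[leRHS]mul1r ler_pM2r//; lra.
  have [s0|s0] := leP 0 (S y n); [left|right]; exists i => //.
    by move: sc; rewrite (ger0_norm s0).
  move: sc; rewrite (ltr0_norm s0) /V/=.
  by rewrite -normrN opprD !opprK mulNr opprK.
have sum_le (g : nat -> R) : (forall i, del <= `|g i|) ->
    (2 * N%:R + 1) * \sum_(i < N) m (V (g i)) <= N%:R * p.
  move=> dg; have -> : N%:R * p = \sum_(i < N) p by rewrite sumr_const card_ord mulr_natl.
  rewrite mulr_sumr.
  by apply: ler_sum => i _; exact/ltW/Vp.
have cb (g : nat -> R) : cylinder n (\bigcup_(i in [set i | (i < N)%N]) V (g i)).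
  by apply: cylinder_bigcup.
have p_le : p <= \sum_(i < N) m (V (c i)) + \sum_(i < N) m (V (- c i)).
  apply: (@le_trans _ _ _ _ _ (law_le mP (n := n) _ _ cover)).
  - exact: (@cylinder_psum _ _ _ (fun s => del * r < `|s| /\ `|s| <= A * r)).
  - exact: cylinderU (cb _) (cb (fun i => - c i)).
  - apply: (le_trans (law_leU mP (cb c) (cb (fun i => - c i)))).
    by rewrite lerD ?(law_bigcup mP (n := n)).
have N0 : 0 <= N%:R :> R by [].
have dN i : del <= `|- c i| by rewrite normrN.
(* Together the two families give [(2 N + 1) p <= 2 N p], which is absurd once [p > 0]: this is the
   reason for the extra 1 in the constant. *)
have h1 := sum_le _ dc; have h2 := sum_le _ dN.
have p0 : 0 < p.
  by apply: le_lt_trans (Vp _ (dc 0%N)); rewrite mulr_ge0 ?(law_ge0 mP)//; lra.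
by nra.
Qed.

End SmallDeviations.

(** * Small deviations *)


Lemma powR_nat_unbounded (R : realType) (e c : R) : 0 < e ->
  exists2 K, (0 < K)%N & forall n, (K <= n)%N -> c < n%:R `^ e.
Proof.
move=> e0; pose c' := Num.max c 0.
have c'0 : 0 <= c' by rewrite le_max lexx orbT.
exists (Num.truncn (c' `^ e^-1)).+1 => // n Kn.
apply: (@le_lt_trans _ _ c'); first by rewrite le_max lexx.
have -> : c' = (c' `^ e^-1) `^ e by rewrite -powRrM mulVf ?gt_eqF// powRr1.
rewrite gt0_ltr_powR// ?nnegrE ?powR_ge0//.
by rewrite (lt_le_trans (truncnS_gt _))// ler_nat.
Qed.

Section Scaling.
Context (R : realType) (m : set (nat -> int) -> R) (mP : walk_law m) (b : R).
Context (b_gt0 : 0 < b).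
Implicit Types (G H : set (nat -> int)) (y : nat -> int).
Local Notation S := (psum R).
(** In the application [b] is [1 / alpha], and [r n] is the order of magnitude of the walk at time
    [n]. *)
Let r (n : nat) : R := n%:R `^ b.

Context (tight : forall eta, 0 < eta -> exists2 A, 0 < A &
  forall n, m [set y | A * r n < `|S y n|] <= eta).
Context (spread : exists2 del, 0 < del & exists n0, forall n, (n0 <= n)%N ->
  del <= m [set y | del * r n < `|S y n|]).

Let r_ge0 n : 0 <= r n. Proof. exact: powR_ge0. Qed.

Let r_gt0 n : (0 < n)%N -> 0 < r n.
Proof. by move=> n0; rewrite powR_gt0// ltr0n. Qed.

Let r_le k n : (k <= n)%N -> r k <= r n.
Proof. by move=> kn; rewrite ge0_ler_powR ?nnegrE ?ler_nat// ltW. Qed.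

Let rM k n : r (k * n) = r k * r n.
Proof. by rewrite /r natrM powRM. Qed.

(** Ottaviani's inequality with a tail bound [eta'] of at most 1/2 loses a factor 2 in probability,
    which the choice of [eta'] at most [eta / 2] absorbs. *)
Lemma tight_max eta : 0 < eta -> exists2 A, 0 < A &
  forall n, m [set y | exists2 j, (j <= n)%N & A * r n < `|S y j|] <= eta.
Proof.
move=> eta0; pose eta' := Num.min (eta / 2) (1 / 2).
have eta'0 : 0 < eta' by rewrite lt_min !divr_gt0.
have [A A0 tA] := tight eta'0.
exists (2 * A) => [|n]; first by rewrite mulr_gt0.
have /(law_max mP) : forall j, (j <= n)%N -> m [set y | A * r n < `|S y j|] <= eta'.
  move=> j jn; apply: le_trans (tA j); apply: (law_le mP (n := j)).
  - exact: (@cylinder_psum _ _ _ (fun s => A * r n < `|s|)).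
  - exact: (@cylinder_psum _ _ _ (fun s => A * r j < `|s|)).
  - by move=> y /=; apply: le_lt_trans; rewrite ler_pM2l ?r_le.
rewrite mulrA; set p := m _.
have p0 : 0 <= p by exact: law_ge0.
have : eta' <= eta / 2 by rewrite ge_min lexx.
have : eta' <= 1 / 2 by rewrite ge_min lexx orbT.
nra.
Qed.

Lemma psum_blocks y K n : S y (K * n) = \sum_(i < K) S (shift (i * n) y) n.
Proof.
elim: K => [|K ih]; first by rewrite mul0n psum0 big_ord0.
by rewrite big_ord_recr/= -ih psum_shift -mulSnr addrC subrK.
Qed.

Lemma law_shift t n G : cylinder n G -> m (shift t @^-1` G) = m G.
Proof.
move=> cG; rewrite -[LHS]/(m (shift t @^-1` G)) -[X in m X]setTI.
by rewrite (law_markov mP (@cylinderT t) cG) (law_setT mP) mul1r.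
Qed.

(* If K consecutive blocks are positive and a proportion of them exceeds
   [del * r n], then the walk at time K n exceeds [K * del^2 / 2 * r n], which
   tightness forbids for large K since [r (K * n) = K^b * r n] and [b < 1]. *)
Lemma one_sided_bound (sg del : R) : b < 1 -> `|sg| = 1 -> 0 < del ->
  exists2 p, 0 < p & forall n, (0 < n)%N ->
    m [set y | del * r n < sg * S y n] < del \/ p <= m [set y | sg * S y n <= 0].
Proof.
move=> b1 sg1 del0.
have [A A0 tA] := tight (divr_gt0 del0 (ltr0n R 8)).
have [K K0 KA] : exists2 K, (0 < K)%N & A * r K < K%:R * (del ^+ 2 / 2).
  have b1' : 0 < 1 - b by rewrite subr_gt0.
  have [K K0 /(_ _ (leqnn _)) h] := powR_nat_unbounded (A / (del ^+ 2 / 2)) b1'.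
  exists K => //; have d2 : 0 < del ^+ 2 / 2 by rewrite divr_gt0 ?exprn_gt0.
  have KE : K%:R = r K * K%:R `^ (1 - b).
    by rewrite /r -powRD ?subrKC ?powRr1// pnatr_eq0 gt_eqF// implybT.
  by rewrite [X in _ < X * _]KE -mulrA [ltLHS]mulrC ltr_pM2l ?r_gt0// -ltr_pdivrMr.
have K0R : 0 < K%:R :> R by rewrite ltr0n.
(* With this bound, the [K] blocks contain a nonpositive one with probability below [del / 8].
   Tightness costs another [del / 8], and the sum is below the [del / 2] found for [Z]. *)
exists (del / 8 / K%:R) => [|n n0]; first by rewrite !divr_gt0.
apply/orP; rewrite -implyNb -leNgt; apply/implyP => big_pos.
rewrite leNgt; apply/negP => small_neg.
pose C0 := [set y | del * r n < sg * S y n].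
pose B0 := [set y | sg * S y n <= 0].
have cC0 : cylinder n C0 by exact: (@cylinder_psum _ _ _ (fun s => del * r n < sg * s)).
have cB0 : cylinder n B0 by exact: (@cylinder_psum _ _ _ (fun s => sg * s <= 0)).
pose sh G (i : nat) := shift (i * n) @^-1` G.
have csh G i : (i < K)%N -> cylinder n G -> cylinder (K * n) (sh G i).
  move=> iK cG; apply: cylinder_le (cylinder_shift cG).
  by rewrite -mulSnr leq_mul2r iK orbT.
(* At this threshold the counting bound reads [K del <= K del / 2 + K m Z]: more than [c] blocks are
   large with probability at least [del / 2]. *)
pose c := Num.truncn (K%:R * del / 2).
have /truncn_itv/andP[cK Kc] : 0 <= K%:R * del / 2.
  by rewrite divr_ge0// mulr_ge0// ltW.
rewrite -/c in cK Kc.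
have := law_count mP c (fun i iK => csh C0 i iK cC0) (@cylinderT _).
set Z := [set y | (_ < _)%N].
rewrite (law_setT mP) mulr1 setTI => count.
have cZ : cylinder (K * n) Z.
  move=> y y' e; rewrite /Z/=.
  rewrite (eq_bigr (fun i : 'I_K => nat_of_bool `[< sh C0 i y' >]))// => i _.
  congr nat_of_bool.
  by apply/asboolP/asboolP; apply: (csh C0 i (ltn_ord i) cC0) => // j /e.
have {}count : del / 2 <= m Z.
  have : K%:R * del <= \sum_(i < K) m (sh C0 i `&` setT).
    rewrite mulr_natl -[X in _ *+ X](card_ord K) -sumr_const; apply: ler_sum => i _.
    by rewrite setIT /sh (law_shift _ cC0).
  move=> /le_trans/(_ count) h.
  rewrite -(ler_pM2l K0R); lra.
pose U := \bigcup_(i in [set i | (i < K)%N]) sh B0 i.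
pose V := [set y | A * r (K * n) < `|S y (K * n)|].
have cU : cylinder (K * n) U by apply: cylinder_bigcup => i iK; exact: csh.
have cV : cylinder (K * n) V.
  exact: (@cylinder_psum _ _ _ (fun s => A * r (K * n) < `|s|)).
have ZUV : Z `<=` U `|` V.
  move=> y Zy; have [Uy|nU] := pselect (U y); [by left|right].
  rewrite /V/=; apply: (@lt_le_trans _ _ (sg * S y (K * n))); last first.
    by rewrite (le_trans (ler_norm _))// normrM sg1 mul1r.
  rewrite psum_blocks mulr_sumr.
  apply: (@lt_le_trans _ _ (c.+1%:R * (del * r n))).
    rewrite rM !mulrA ltr_pM2r ?r_gt0//; apply: (lt_trans KA).
    by rewrite -(ltr_pM2r del0) in Kc; lra.
  apply: (@le_trans _ _ (\sum_(i < K) `[< sh C0 i y >]%:R * (del * r n))).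
    rewrite -mulr_suml ler_pM2r ?mulr_gt0 ?r_gt0// -natr_sum ler_nat.
    exact: Zy.
  apply: ler_sum => i _; case: asboolP => Ci; first by rewrite mul1r; exact: ltW.
  rewrite mul0r; apply: ltW; rewrite ltNge; apply/negP => Bi; apply: nU.
  by exists i => //=.
have := law_le mP cZ (cylinderU cU cV) ZUV.
have := law_leU mP cU cV.
have : m U <= K%:R * m B0.
  apply: (le_trans (law_bigcup mP (fun i iK => csh B0 i iK cB0))).
  rewrite mulr_natl -[X in _ *+ X](card_ord K) -sumr_const; apply: ler_sum => i _.
  by rewrite /sh (law_shift _ cB0).
have := tA (K * n)%N; rewrite -/V.
move: small_neg; rewrite ltr_pdivlMr// -/B0 mulrC; lra.
Qed.

(** If large values on one side are rare, [spread] puts large values on the other side with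
    probability at least [del / 2]. If they are not rare, [one_sided_bound] directly bounds below
    the probability of the opposite sign. *)
Lemma two_sided : b < 1 -> exists2 p, 0 < p & exists n0, forall n, (n0 <= n)%N ->
  p <= m [set y | 0 <= S y n] /\ p <= m [set y | S y n <= 0].
Proof.
move=> b1; have [del del0 [n0 sp]] := spread.
have del20 : 0 < del / 2 by rewrite divr_gt0.
have [p1 p10 pos] := one_sided_bound b1 (normr1 R) del20.
have [p2 p20 neg] := one_sided_bound b1 (normrN1 R) del20.
pose p := Num.min (del / 2) (Num.min p1 p2).
have [pd pp1 pp2] : [/\ p <= del / 2, p <= p1 & p <= p2].
  by rewrite /p !ge_min !lexx/= !orbT.
exists p => [|]; first by rewrite !lt_min del20 p10 p20.
exists (maxn n0 1) => n; rewrite geq_max => /andP[n0n n1].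
have r0 := r_gt0 n1.
have cyl (Q : R -> Prop) : cylinder n [set y | Q (psum R y n)] by exact: cylinder_psum.
have split_spread : del <= m [set y | del / 2 * r n < 1 * S y n] +
    m [set y | del / 2 * r n < -1 * S y n].
  apply: (le_trans (sp n n0n)).
  apply: le_trans (law_leU mP (n := n) _ _).
  - apply: (law_le mP (n := n)).
    + exact: (cyl (fun s => del * r n < `|s|)).
    + apply: cylinderU.
        exact: (cyl (fun s => del / 2 * r n < 1 * s)).
      exact: (cyl (fun s => del / 2 * r n < -1 * s)).
    + move=> y /= h; have dr : 0 < del * r n by rewrite mulr_gt0.
      have [s0|s0] := leP 0 (S y n); [left|right].
        by move: h; rewrite ger0_norm//; lra.
      by move: h; rewrite ltr0_norm//; lra.
  - exact: (cyl (fun s => del / 2 * r n < 1 * s)).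
  - exact: (cyl (fun s => del / 2 * r n < -1 * s)).
have eP : m [set y | 0 <= S y n] = m [set y | -1 * S y n <= 0].
  by congr m; apply/seteqP; split => y /=; lra.
have eN : m [set y | S y n <= 0] = m [set y | 1 * S y n <= 0].
  by congr m; apply/seteqP; split => y /=; lra.
have big (sg : R) : m [set y | del / 2 * r n < sg * S y n] <= m [set y | 0 <= sg * S y n].
  apply: (law_le mP (n := n)).
  - exact: (cyl (fun s => del / 2 * r n < sg * s)).
  - exact: (cyl (fun s => 0 <= sg * s)).
  - by move=> y /= /ltW; apply: le_trans; rewrite mulr_ge0// ltW.
have eP' : m [set y | 0 <= S y n] = m [set y | 0 <= 1 * S y n].
  by congr m; apply/seteqP; split => y /=; lra.
have eN' : m [set y | S y n <= 0] = m [set y | 0 <= -1 * S y n].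
  by congr m; apply/seteqP; split => y /=; lra.
have b1' := big 1; have b2' := big (-1).
split.
  have [h|h] := neg n n1; last by rewrite eP; lra.
  by rewrite eP'; lra.
have [h|h] := pos n n1; last by rewrite eN; lra.
by rewrite eN'; lra.
Qed.


Let cyl_ball k n c : (k <= n)%N ->
  cylinder n [set y | forall j, (j <= k)%N -> `|S y j| <= c].
Proof.
move=> kn; apply: (@cylinder_psums _ n (fun j => (j <= k)%N) (fun=> fun s => `|s| <= c)).
by move=> j /leq_trans; exact.
Qed.

Let ball_setC k c : [set y | forall j, (j <= k)%N -> `|S y j| <= c] =
  ~` [set y | exists2 j, (j <= k)%N & c < `|S y j|].
Proof.
apply/seteqP; split => y /=.
  by move=> h [j /h]; rewrite leNgt => /negP.
by move=> h j jk; rewrite leNgt; apply/negP => cj; apply: h; exists j.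
Qed.

Let law_ball n c : m [set y | forall j, (j <= n)%N -> `|S y j| <= c] =
  1 - m [set y | exists2 j, (j <= n)%N & c < `|S y j|].
Proof.
have := cylinderC (cyl_ball (c := c) (leqnn n)).
by rewrite ball_setC setCK => /(law_setC mP).
Qed.

(* For b > 1 it is enough that each of K blocks moves by at most [A * r n]:
   the total is at most [K * A * r n], which is small against [K^b * r n]. *)
Lemma small_deviation_gt1 eps : 1 < b -> 0 < eps ->
  exists2 K, (0 < K)%N & exists2 p, 0 < p & forall n,
  p <= m [set y | forall j, (j <= K * n)%N -> `|S y j| <= eps * r (K * n)].
Proof.
move=> b1 eps0; have [A A0 tA] := tight_max (divr_gt0 ltr01 (ltr0n R 2)).
have [K K0 KA] : exists2 K, (0 < K)%N & K%:R * A <= eps * r K.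
  have b1' : 0 < b - 1 by rewrite subr_gt0.
  have [K K0 /(_ _ (leqnn _)) h] := powR_nat_unbounded (A / eps) b1'.
  exists K => //.
  have -> : r K = K%:R * K%:R `^ (b - 1).
    rewrite /r -[X in _ = X * _]powRr1// -powRD ?subrKC//.
    by rewrite pnatr_eq0 gt_eqF// implybT.
  rewrite mulrCA ler_pM2l ?ltr0n// mulrC -ler_pdivrMr//; exact: ltW.
exists K => //; exists ((1 / 2) ^+ K) => [|n]; first by rewrite exprn_gt0.
have ball1 : 1 / 2 <= m [set y | forall j, (j <= n)%N -> `|S y j| <= A * r n].
  by rewrite law_ball; move: (tA n); lra.
(* The blocks are concatenated by the Markov property, each contributing a factor 1/2 and at most
   [A * r n] of displacement. *)
apply: (@le_trans _ _ (m [set y | forall j, (j <= K * n)%N -> `|S y j| <= K%:R * (A * r n)])).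
  elim: K {K0 KA} => [|K ih].
    rewrite expr0 mul0n -(law_setT mP) (law_le mP (@cylinderT 0) (cyl_ball (leq0n _)))//.
    by move=> y _ j; rewrite leqn0 => /eqP ->; rewrite psum0 normr0 mul0r.
  rewrite exprSr; apply: le_trans (ler_pM _ _ ih ball1) _ => //.
  rewrite -(law_markov mP (cyl_ball (leqnn _)) (cyl_ball (leqnn _))).
  apply: (law_le mP (n := K.+1 * n)).
  - apply: cylinderI; first by apply: cyl_ball; rewrite leq_mul2r leqnSn orbT.
    by rewrite [X in cylinder X]mulSnr; apply: cylinder_shift; exact: cyl_ball.
  - exact: cyl_ball.
  - move=> y [h1 h2] j jK; have Ar : 0 <= A * r n by rewrite mulr_ge0// ltW.
    rewrite -natr1 mulrDl mul1r.
    have [jK'|Kj] := leqP j (K * n); first by rewrite (le_trans (h1 _ jK'))// lerDl.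
    have jE : j = (K * n + (j - K * n))%N by rewrite subnKC// ltnW.
    have /h2 : (j - K * n <= n)%N by rewrite leq_subLR -mulSnr.
    rewrite psum_shift -jE => h3; have := h1 _ (leqnn _).
    have := ler_normD (S y (K * n)) (S y j - S y (K * n)); rewrite subrKC; lra.
apply: (law_le mP (n := K * n)); [exact: cyl_ball|exact: cyl_ball|].
move=> y h j /h /le_trans; apply.
by rewrite rM !mulrA ler_wpM2r.
Qed.

(* For b < 1 the walk is steered: each block goes in the direction opposite to
   the current position, so that the end points stay in [-A r n, A r n]. *)
Lemma small_deviation_lt1 eps : b < 1 -> 0 < eps ->
  exists2 K, (0 < K)%N & exists2 p, 0 < p & exists n0, forall n, (n0 <= n)%N ->
  p <= m [set y | forall j, (j <= K * n)%N -> `|S y j| <= eps * r (K * n)].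
Proof.
move=> b1 eps0; have [q q0 [n0 two]] := two_sided b1.
have [A A0 tA] := tight_max (divr_gt0 q0 (ltr0n R 2)).
have [K K0 KA] := powR_nat_unbounded (2 * A / eps) b_gt0.
exists K => //; exists ((q / 2) ^+ K) => [|]; first by rewrite exprn_gt0// divr_gt0.
exists n0 => n n0n; have [qp qn] := two n n0n.
have Ar : 0 <= A * r n by rewrite mulr_ge0// ltW.
pose ball := [set y | forall j, (j <= n)%N -> `|S y j| <= A * r n].
have cball : cylinder n ball by exact: cyl_ball.
have cyl k (Q : R -> Prop) : cylinder k [set y | Q (psum R y k)] by exact: cylinder_psum.
(* Requiring in addition that the block stay in the ball costs at most [q / 2]. *)
have mball (Q : R -> Prop) : q <= m [set y | Q (S y n)] ->
    q / 2 <= m ([set y | Q (S y n)] `&` ball).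
  move=> Qq; have := law_split mP (cyl n Q) cball.
  have : m ([set y | Q (S y n)] `&` ~` ball) <= m (~` ball).
    apply: (law_le mP (n := n)) => [| |y []//].
      by apply: cylinderI (cylinderC cball).
    exact: cylinderC.
  by rewrite (law_setC mP cball) law_ball; move: (tA n); lra.
(* The end point returns to [[- A r n, A r n]], which lets the induction continue, while inside a
   block the path may reach [2 A r n]. The choice of [K] makes this at most [eps * r (K * n)]. *)
pose B K := [set y | forall j, (j <= K * n)%N -> `|S y j| <= 2 * (A * r n)] `&`
  [set y | `|S y (K * n)| <= A * r n].
have cB k : cylinder (k * n) (B k).
  apply: cylinderI; first exact: cyl_ball.
  exact: (cyl _ (fun s => `|s| <= A * r n)).
suff BK k : (q / 2) ^+ k <= m (B k).
  apply: le_trans (BK K) _; apply: (law_le mP (n := K * n)); [exact: cB|exact: cyl_ball|].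
  move=> y [h _] j /h /le_trans; apply.
  rewrite rM !mulrA ler_wpM2r ?r_ge0// [leRHS]mulrC -ler_pdivrMr// ltW//.
  exact: (KA _ (leqnn _)).
elim: k => [|k ih].
  rewrite expr0 -(law_setT mP) (law_le mP (@cylinderT 0) (cB 0%N))//.
  move=> y _; split => [j|]/=; rewrite ?mul0n ?leqn0.
    by move=> /eqP ->; rewrite psum0 normr0 mulr_ge0.
  by rewrite psum0 normr0.
pose G := [set y | 0 <= S y (k * n)].
have cG : cylinder (k * n) G by exact: (cyl _ (fun s => 0 <= s)).
pose dn := [set y | S y n <= 0] `&` ball.
pose up := [set y | 0 <= S y n] `&` ball.
have cdn : cylinder n dn by apply: cylinderI cball; exact: (cyl _ (fun s => s <= 0)).
have cup : cylinder n up by apply: cylinderI cball; exact: (cyl _ (fun s => 0 <= s)).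
have dnq : q / 2 <= m dn by exact: (mball (fun s => s <= 0)).
have upq : q / 2 <= m up by exact: (mball (fun s => 0 <= s)).
pose D1 := (B k `&` G) `&` shift (k * n) @^-1` dn.
pose D2 := (B k `&` ~` G) `&` shift (k * n) @^-1` up.
have cBG : cylinder (k * n) (B k `&` G) by exact: cylinderI.
have cBG' : cylinder (k * n) (B k `&` ~` G) by apply: cylinderI => //; exact: cylinderC.
have cD1 : cylinder (k.+1 * n) D1.
  rewrite mulSnr; apply: cylinderI; last exact: cylinder_shift.
  by apply: cylinder_le cBG; rewrite leq_addr.
have cD2 : cylinder (k.+1 * n) D2.
  rewrite mulSnr; apply: cylinderI; last exact: cylinder_shift.
  by apply: cylinder_le cBG'; rewrite leq_addr.
apply: (@le_trans _ _ (m (D1 `|` D2))).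
  rewrite (law_setU mP cD1 cD2); last first.
    by rewrite -subset0 => y [[[_ Gy] _] [[_ /(_ Gy)]]].
  rewrite (law_markov mP cBG cdn) (law_markov mP cBG' cup) exprSr.
  have := law_split mP (cB k) cG.
  have := law_ge0 mP (B k `&` G); have := law_ge0 mP (B k `&` ~` G).
  by have : 0 < q / 2 by [rewrite divr_gt0|]; nra.
have step y s : B k y -> ball (shift (k * n) y) -> S (shift (k * n) y) n = s ->
    `|S y (k * n) + s| <= A * r n -> B k.+1 y.
  move=> [h1 h2] h3 sE h4; split => /=; last first.
    by move: h4; rewrite -sE psum_shift subrKC -mulSnr.
  move=> j jK; have [jk|kj] := leqP j (k * n); first exact: h1.
  have jE : j = (k * n + (j - k * n))%N by rewrite subnKC// ltnW.
  have /h3 : (j - k * n <= n)%N by rewrite leq_subLR -mulSnr.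
  rewrite psum_shift -jE => h5; rewrite /= in h2.
  have := ler_normD (S y (k * n)) (S y j - S y (k * n)); rewrite subrKC; lra.
apply: (law_le mP (n := k.+1 * n)) => //; first exact: cylinderU.
move=> y [[[By Gy] [/= d1 d2]]|[[By /negP]]]; last first.
  rewrite -ltNge => Gy [/= d1 d2]; apply: (step y _ By d2 erefl).
  move: (d2 n (leqnn _)) By => + [_ /=].
  by rewrite (ger0_norm d1) (ltr0_norm Gy) ler_norml => h1 h2; apply/andP; split; lra.
rewrite /G/= in Gy; apply: (step y _ By d2 erefl).
move: (d2 n (leqnn _)) By => + [_ /=].
by rewrite (ler0_norm d1) (ger0_norm Gy) ler_norml => h1 h2; apply/andP; split; lra.
Qed.

(** By pigeonhole the walk at time [K * n] is near some [x] of modulus at least [del * r (K * n)];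
    it then moves little during three more periods of that length. The first period is the excluded
    first quarter of the total time [4 * (K * n)]. *)
Lemma confinement eps : b != 1 -> 0 < eps -> exists2 p, 0 < p &
  forall N : nat, exists2 n, (N <= n)%N & exists2 x : R, N%:R <= `|x| &
  p <= m [set y | forall j, (n <= 4 * j)%N /\ (j <= n)%N -> `|S y j - x| <= eps * `|x|].
Proof.
move=> b1 eps0; have [del del0 [n0 sp]] := spread.
have [A A0 tA] := tight (divr_gt0 del0 (ltr0n R 2)).
(* Two errors of [e1 * r (K * n)] add up to at most [eps * |x|]. Dividing by [r 3] in [e2]
   compensates for the second phase being three times longer. *)
pose e1 := eps * del / 2; have e10 : 0 < e1 by rewrite divr_gt0// mulr_gt0.
pose e2 := e1 / r 3; have e20 : 0 < e2 by rewrite divr_gt0// r_gt0.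
have [K K0 [p1 p10 [n1 sd]]] : exists2 K, (0 < K)%N & exists2 p, 0 < p &
    exists n0, forall n, (n0 <= n)%N ->
    p <= m [set y | forall j, (j <= K * n)%N -> `|S y j| <= e2 * r (K * n)].
  move: b1; rewrite neq_lt => /orP[b1|b1]; first exact: small_deviation_lt1.
  have [K K0 [p p0 h]] := small_deviation_gt1 b1 e20.
  by exists K => //; exists p => //; exists 0%N.
pose N1 := (Num.truncn (A / e1)).+1.
have AN1 : A <= N1%:R * e1 by rewrite -ler_pdivrMr// ltW// truncnS_gt.
(* Of the mass [del] given by [spread], at least [del / 2] survives the truncation at [A]; the
   pigeonhole divides it by [2 * N1 + 1]. *)
pose p2 := del / 2 / (2 * N1%:R + 1).
have N1' : 0 < 2 * N1%:R + 1 :> R by rewrite ltr_wpDl// mulr_ge0.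
have p20 : 0 < p2 by rewrite !divr_gt0.
exists (p2 * p1) => [|N]; first exact: mulr_gt0.
have [k k0 kN] := powR_nat_unbounded (N%:R / del) b_gt0.
have [n [Nn n0n n1n kn]] : exists n, [/\ N <= n, n0 <= n, n1 <= n & k <= n]%N.
  by exists (maxn N (maxn n0 (maxn n1 k))); rewrite !leq_max !leqnn !orbT.
have KnN : (n <= K * n)%N by rewrite leq_pmull.
have n_gt0 : (0 < K * n)%N by rewrite muln_gt0 K0; exact: leq_trans kn.
have [c [dc mc]] := law_pigeonhole mP (K * n) (r_gt0 n_gt0) del0 e10 AN1.
pose x := c * r (K * n).
have xd : del * r (K * n) <= `|x| by rewrite normrM (ger0_norm (r_ge0 _)) ler_wpM2r.
exists (4 * (K * n))%N; first by apply: leq_trans Nn (leq_trans KnN _); rewrite leq_pmull.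
exists x.
  apply: le_trans xd; rewrite mulrC -ler_pdivrMr// ltW// kN//.
  exact: leq_trans KnN.
pose V := [set y | `|S y (K * n) - x| <= e1 * r (K * n)].
have cV : cylinder (K * n) V.
  exact: (@cylinder_psum _ _ _ (fun s => `|s - x| <= e1 * r (K * n))).
pose W := [set y | forall j, (j <= K * (3 * n))%N -> `|S y j| <= e2 * r (K * (3 * n))].
have cW : cylinder (K * (3 * n)) W by exact: cyl_ball.
have Wp : p1 <= m W by apply: sd; rewrite (leq_trans n1n)// leq_pmull.
have Vp : p2 <= m V.
  rewrite ler_pdivrMr// [leRHS]mulrC; apply: le_trans mc.
  have cyl (Q : R -> Prop) : cylinder (K * n) [set y | Q (psum R y (K * n))].
    exact: cylinder_psum.
  have := law_leU mP (cyl (fun s => del * r (K * n) < `|s| /\ `|s| <= A * r (K * n)))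
    (cyl (fun s => A * r (K * n) < `|s|)).
  have := tA (K * n)%N.
  have : del <= m ([set y | del * r (K * n) < `|S y (K * n)| /\ `|S y (K * n)| <= A * r (K * n)] `|`
      [set y | A * r (K * n) < `|S y (K * n)|]).
    apply: le_trans (sp (K * n)%N (leq_trans n0n KnN)) _.
    apply: (law_le mP (n := K * n)).
    - exact: (cyl (fun s => del * r (K * n) < `|s|)).
    - apply: cylinderU.
        exact: (cyl (fun s => del * r (K * n) < `|s| /\ `|s| <= A * r (K * n))).
      exact: (cyl (fun s => A * r (K * n) < `|s|)).
    - by move=> y /= h; have [h'|h'] := leP `|S y (K * n)| (A * r (K * n)); [left|right].
  lra.
apply: (@le_trans _ _ (m V * m W)); first by apply: ler_pM => //; exact: ltW.
rewrite -(law_markov mP cV cW); apply: (law_le mP (n := 4 * (K * n))).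
- have -> : (4 * (K * n) = K * n + K * (3 * n))%N by clear; lia.
  apply: cylinderI; last exact: cylinder_shift.
  by apply: cylinder_le cV; rewrite leq_addr.
- apply: (@cylinder_psums _ _ (fun j => (4 * (K * n) <= 4 * j)%N /\ (j <= 4 * (K * n))%N)
    (fun=> fun s => `|s - x| <= eps * `|x|)) => j [_]//.
- move=> y [/= Vy Wy] j [j1 j2].
  have j3 : (K * n <= j)%N by rewrite -(leq_pmul2l (isT : (0 < 4)%N)).
  have /Wy : (j - K * n <= K * (3 * n))%N by move: j2; clear; lia.
  rewrite psum_shift subnKC//.
  have -> : e2 * r (K * (3 * n)) = e1 * r (K * n).
    by rewrite mulnCA rM /e2 mulrA divfK// gt_eqF// r_gt0.
  have := ler_normD (S y (K * n) - x) (S y j - S y (K * n)).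
  rewrite addrC addrA subrK.
  have : e1 * r (K * n) + e1 * r (K * n) <= eps * `|x|.
    rewrite -mulrDl /e1 -splitr -mulrA ler_pM2l//.
  move: Vy; rewrite /V/=; lra.
Qed.

End Scaling.

(** * The law of an i.i.d. sequence *)


Section CountableConditioning.
Context (R : realType) (disp : measure_display) (T : measurableType disp).
Context (P : probability T R) (C : countType).

Lemma preimage_countable_measurable (Z : T -> C) (B : set C) :
  (forall s, measurable [set w | Z w = s]) -> measurable (Z @^-1` B).
Proof.
move=> mZ.
have -> : Z @^-1` B =
    \bigcup_i [set w | exists s, [/\ choice.pickle s = i, B s & Z w = s]].
  apply/seteqP; split => w /=; last by move=> [i _ [s [_ + ->]]].
  by move=> Bw; exists (choice.pickle (Z w)) => //; exists (Z w).
apply: bigcupT_measurable => i.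
have [[s [si Bs]]|nos] := pselect (exists s, choice.pickle s = i /\ B s).
  rewrite (_ : mkset _ = [set w | Z w = s])//.
  apply/seteqP; split => w /=; last by move=> ->; exists s.
  by move=> [s' [s'i _ ->]]; apply: (pcan_inj choice.pickleK); rewrite s'i.
rewrite (_ : mkset _ = set0)// -subset0 => w [s [si Bs _]].
by apply: nos; exists s.
Qed.

Lemma measure_countable_partition (Z : T -> C) (E : set T) :
  (forall s, measurable [set w | Z w = s]) -> measurable E ->
  P E = (\sum_(i <oo) P (E `&` [set w | choice.pickle (Z w) = i]))%E.
Proof.
move=> mZ mE.
have {1}-> : E = \bigcup_(i in setT) (E `&` [set w | choice.pickle (Z w) = i]).
  by rewrite -setI_bigcupr (_ : bigcup _ _ = setT) ?setIT// -subTset => w _; exists (choice.pickle (Z w)).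
rewrite measure_bigcup.
- by apply: eq_eseriesl => i; rewrite in_setT.
- move=> i _; apply: measurableI => //.
  exact: (preimage_countable_measurable (fun s => choice.pickle s = i) mZ).
- by apply/trivIsetP => i j _ _ ij; rewrite -subset0 => w [[_ /= ->] [_ /= /eqP]]; rewrite (negPf ij).
Qed.

(** Reduces a product formula to single values of discrete variables, which is how the Markov
    property is obtained below. *)
Lemma measure_eq_countable_partition (Z Z' : T -> C) (E E' : set T) (a : R) :
  (forall s, measurable [set w | Z w = s]) -> (forall s, measurable [set w | Z' w = s]) ->
  measurable E -> measurable E' ->
  (forall s, P (E `&` [set w | Z w = s]) = a%:E * P (E' `&` [set w | Z' w = s]))%E ->
  (P E = a%:E * P E')%E.
Proof.
move=> mZ mZ' mE mE' eZ.
rewrite (measure_countable_partition mZ mE) (measure_countable_partition mZ' mE').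
rewrite -nneseriesZl//; apply: eq_eseriesr => i _.
have [[s si]|nos] := pselect (exists s : C, choice.pickle s = i).
  have e (U : T -> C) : [set w | choice.pickle (U w) = i] = [set w | U w = s].
    apply/seteqP; split => w /=; last by move=> ->.
    by rewrite -si => /(pcan_inj choice.pickleK).
  by rewrite !e eZ.
have e (U : T -> C) : [set w | choice.pickle (U w) = i] = set0.
  by rewrite -subset0 => w /= Ui; apply: nos; exists (U w).
by rewrite !e !setI0 !measure0 mule0.
Qed.

End CountableConditioning.

Section LawOfIid.
Context (R : realType) (disp : measure_display) (T : measurableType disp).
Context (P : probability T R) (Y : nat -> T -> int).
Context (measurable_Y : forall n (A : set int), measurable (Y n @^-1` A)).
Context (indep_Y : forall (J : seq nat) (A : nat -> set int), uniq J ->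
  P (\bigcap_(j in [set` J]) (Y j @^-1` A j)) = (\prod_(j <- J) P (Y j @^-1` A j))%E).
Context (ident_Y : forall n (A : set int), P (Y n @^-1` A) = P (Y 0%N @^-1` A)).

Definition path_of (w : T) : nat -> int := fun i => Y i w.

(** Defined on all sets, but meant for cylinders, whose preimages are measurable. *)
Definition path_law (G : set (nat -> int)) : R := fine (P (path_of @^-1` G)).

Let block t n (w : T) : seq int := [seq Y i w | i <- iota t n].

Let size_block t n w : size (block t n w) = n.
Proof. by rewrite size_map size_iota. Qed.

Let blockE t n s : size s = n ->
  [set w | block t n w = s] =
  \bigcap_(j in [set` iota t n]) (Y j @^-1` [set nth 0 s (j - t)]).
Proof.
move=> sn; apply/seteqP; split => w /=.
  move=> <- j /=; rewrite mem_iota => /andP[tj jn].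
  have jt : (j - t < n)%N by rewrite ltn_subLR.
  by rewrite (nth_map 0%N) ?size_iota// nth_iota// subnKC.
move=> h; apply: (@eq_from_nth _ 0); rewrite size_block// => i i_n.
rewrite (nth_map 0%N) ?size_iota// nth_iota//.
have /h/= -> : [set` iota t n] (t + i)%N by rewrite /= mem_iota leq_addr ltn_add2l.
by rewrite addKn.
Qed.

Let block0 t n s : size s <> n -> [set w | block t n w = s] = set0.
Proof. by move=> sn; rewrite -subset0 => w /= ws; apply: sn; rewrite -ws size_block. Qed.

Let measurable_block t n s : measurable [set w | block t n w = s].
Proof.
have [/eqP sn|/eqP sn] := boolP (size s == n); last by rewrite block0.
by rewrite blockE//; apply: fin_bigcap_measurable => //; exact: finite_seq.
Qed.

Let point_law (s : seq int) := (\prod_(a <- s) P (Y 0%N @^-1` [set a]))%E.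

Let point_law_block t n s : size s = n ->
  P [set w | block t n w = s] = point_law s.
Proof.
move=> sn; rewrite blockE// indep_Y ?iota_uniq// /point_law.
rewrite [RHS](big_nth 0) sn /index_iota subn0.
have -> : iota t n = [seq (t + i)%N | i <- iota 0 n] by rewrite -iotaDl addn0.
rewrite big_map; apply: eq_bigr => i _.
by rewrite ident_Y addKn.
Qed.

Let block_cat t n w : block 0 (t + n) w = block 0 t w ++ block t n w.
Proof. by rewrite /block iotaD map_cat. Qed.

Let cylinderE t n G w : cylinder n G ->
  G (shift t (path_of w)) <-> G (nth 0 (block t n w)).
Proof.
move=> cG; have e i : (i < n)%N -> shift t (path_of w) i = nth 0 (block t n w) i.
  by move=> i_n; rewrite (nth_map 0%N) ?size_iota// nth_iota.
by split; apply: cG => i /e.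
Qed.

Let cylinder_preimage t n G : cylinder n G ->
  [set w | G (shift t (path_of w))] = block t n @^-1` [set s | G (nth 0 s)].
Proof. by move=> cG; apply/seteqP; split => w /=; rewrite (cylinderE _ _ cG). Qed.

Let measurable_shift t n G : cylinder n G ->
  measurable [set w | G (shift t (path_of w))].
Proof.
move=> cG; rewrite (cylinder_preimage _ cG).
by apply: preimage_countable_measurable => s; exact: measurable_block.
Qed.

Lemma measurable_cylinder n G : cylinder n G -> measurable (path_of @^-1` G).
Proof.
move=> cG; have := measurable_shift 0 cG.
by rewrite (_ : [set w | _] = path_of @^-1` G).
Qed.

(** Once the later block is also fixed to a word [s'], either [G] excludes it on both sides, or the
    event prescribes all [t + n] increments and its probability is a product over the letters. *)
Let markov_point t n s G : cylinder n G ->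
  P ([set w | block 0 t w = s] `&` [set w | G (shift t (path_of w))]) =
  (P [set w | block 0 t w = s] * P (path_of @^-1` G))%E.
Proof.
move=> cG.
have Pfin A : measurable A -> P A = (fine (P A))%:E.
  by move=> mA; rewrite fineK// fin_num_measure.
have mG := measurable_cylinder cG.
have mGt := measurable_shift t cG.
rewrite (Pfin [set w | block 0 t w = s])//.
apply: (@measure_eq_countable_partition _ _ _ _ _ (block t n) (block 0 n)) => //.
  exact: measurableI.
move=> s'; rewrite -(Pfin [set w | block 0 t w = s])//.
have [/eqP sn|/eqP sn] := boolP (size s == t); last first.
  by rewrite block0// !set0I measure0 mul0e.
have [/eqP sn'|/eqP sn'] := boolP (size s' == n); last first.
  by rewrite !(block0 _ sn') !setI0 !measure0 mule0.
have [Gs|nGs] := pselect (G (nth 0 s')).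
  have -> : [set w | block 0 t w = s] `&` [set w | G (shift t (path_of w))]
      `&` [set w | block t n w = s'] = [set w | block 0 (t + n) w = s ++ s'].
    apply/seteqP; split => w /=; first by move=> [[e _] e']; rewrite block_cat e e'.
    rewrite block_cat => /eqP; rewrite eqseq_cat ?size_block// => /andP[/eqP e /eqP e'].
    by split => //; split => //; rewrite (cylinderE _ _ cG) e'.
  have -> : path_of @^-1` G `&` [set w | block 0 n w = s'] = [set w | block 0 n w = s'].
    apply/setIidr => w /= e; rewrite -[path_of w]/(shift 0 (path_of w)).
    by rewrite (cylinderE _ _ cG) e.
  by rewrite !point_law_block ?size_cat ?sn ?sn'// /point_law big_cat.
have -> : [set w | block 0 t w = s] `&` [set w | G (shift t (path_of w))]
      `&` [set w | block t n w = s'] = set0.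
  rewrite -subset0 => w [[_ /=]]; rewrite (cylinderE _ _ cG) => + /= e.
  by rewrite e.
have -> : path_of @^-1` G `&` [set w | block 0 n w = s'] = set0.
  rewrite -subset0 => w [/=]; rewrite -[path_of w]/(shift 0 (path_of w)).
  by rewrite (cylinderE _ _ cG) => + e; rewrite e.
by rewrite !measure0 mule0.
Qed.

Lemma path_law_walk_law : walk_law path_law.
Proof.
have Pfin A : measurable A -> P A = (fine (P A))%:E.
  by move=> mA; rewrite fineK// fin_num_measure.
split.
- by move=> G; rewrite /path_law fine_ge0.
- by rewrite /path_law preimage_setT probability_setT.
- move=> n G H cG cH GH; rewrite /path_law preimage_setU measureU.
  + rewrite fineD// fin_num_measure//; first exact: measurable_cylinder cG.
    exact: measurable_cylinder cH.
  + exact: measurable_cylinder cG.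
  + exact: measurable_cylinder cH.
  + by rewrite -preimage_setI GH preimage_set0.
- move=> t n G H cG cH; rewrite /path_law preimage_setI.
  have mG := measurable_cylinder cG; have mH := measurable_cylinder cH.
  have mHt := measurable_shift t cH.
  rewrite -fineM ?fin_num_measure//; congr fine.
  rewrite muleC (Pfin _ mH).
  apply: (@measure_eq_countable_partition _ _ _ _ _ (block 0 t) (block 0 t)) => //.
    exact: measurableI.
  (* The first block [s] decides whether [G] holds, so either both sides vanish or [markov_point]
     applies. *)
  move=> s; rewrite -(Pfin _ mH).
  have [Gs|nGs] := pselect (G (nth 0 s)).
    have -> : path_of @^-1` G `&` path_of @^-1` (shift t @^-1` H) `&`
        [set w | block 0 t w = s] =
        [set w | block 0 t w = s] `&` [set w | H (shift t (path_of w))].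
      apply/seteqP; split => w /=; first by move=> [[_ h] e].
      move=> [e h]; split => //; split => //.
      by rewrite -[path_of w]/(shift 0 (path_of w)) (cylinderE _ _ cG) e.
    have -> : path_of @^-1` G `&` [set w | block 0 t w = s] = [set w | block 0 t w = s].
      apply/setIidr => w /= e; rewrite -[path_of w]/(shift 0 (path_of w)).
      by rewrite (cylinderE _ _ cG) e.
    by rewrite (markov_point _ _ cH) muleC.
  have -> : path_of @^-1` G `&` [set w | block 0 t w = s] = set0.
    rewrite -subset0 => w [/=]; rewrite -[path_of w]/(shift 0 (path_of w)).
    by rewrite (cylinderE _ _ cG) => + e; rewrite e.
  have -> : path_of @^-1` G `&` path_of @^-1` (shift t @^-1` H) `&`
        [set w | block 0 t w = s] = set0.
    rewrite -subset0 => w [[/=]]; rewrite -[path_of w]/(shift 0 (path_of w)).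
    by rewrite (cylinderE _ _ cG) => + _ e; rewrite e.
  by rewrite !measure0 mule0.
Qed.

End LawOfIid.

(** * Consequences of convergence in law *)


(* A continuous function between the indicators of ]2a, +oo[ and ]a, +oo[. *)
Definition ramp (R : realType) (a t : R) : R := Num.min 1 (Num.max 0 (t / a - 1)).

Lemma ramp_ge0 (R : realType) (a t : R) : 0 <= ramp a t.
Proof. by rewrite le_min ler01 le_max lexx. Qed.

Lemma ramp_le1 (R : realType) (a t : R) : ramp a t <= 1.
Proof. by rewrite ge_min lexx. Qed.

Lemma continuous_ramp (R : realType) (a : R) : continuous (ramp a).
Proof.
move=> x.
have c0 : {for x, continuous (fun t : R => t / a - 1)}.
  by apply: cvgB; [apply: cvgM; [exact: cvg_id|exact: cvg_cst]|exact: cvg_cst].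
have c1 := continuous_max (@cst_continuous R R 0 x) c0.
exact: (continuous_min (@cst_continuous R R 1 x) c1).
Qed.

Section RampIntegral.
Context (R : realType) (disp : measure_display) (T : measurableType disp).
Context (P : probability T R) (h : T -> R).
Context (mh : measurable_fun setT h).

Lemma measurable_gt a : measurable [set w | a < h w].
Proof.
have := mh measurableT (measurable_itv `]a, +oo[); rewrite setTI.
rewrite (_ : _ @^-1` _ = [set w | a < h w])//.
by apply/seteqP; split => w /=; rewrite in_itv/= andbT.
Qed.

Lemma measurable_ramp a : measurable_fun setT (EFin \o (ramp a \o h)).
Proof.
apply/measurable_EFinP; apply: measurableT_comp mh.
by apply: continuous_measurable_fun; exact: continuous_ramp.
Qed.

Lemma ramp_integral_ge a : 0 < a ->
  (P [set w | (2 * a < h w)%R] <= \int[P]_w (ramp a (h w))%:E)%E.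
Proof.
move=> a0; have mB := measurable_gt (2 * a).
rewrite -[in leLHS](setIT [set w | _]) -(integral_indic _ measurableT mB).
apply: ge0_le_integral => //.
- exact/measurable_EFinP/measurable_indic.
- exact: measurable_ramp.
- move=> w _; rewrite lee_fin indicE; have [hw|hw] := boolP (w \in _); last exact: ramp_ge0.
  have {}hw : 2 * a < h w by exact: set_mem hw.
  rewrite /= /ramp.
  rewrite le_min lexx le_max; apply/orP; right.
  by rewrite lerBrDr ler_pdivlMr//; lra.
Qed.

Lemma ramp_integral_le a : 0 < a ->
  (\int[P]_w (ramp a (h w))%:E <= P [set w | (a < h w)%R])%E.
Proof.
move=> a0; have mB := measurable_gt a.
rewrite -[in leRHS](setIT [set w | _]) -(integral_indic _ measurableT mB).
apply: ge0_le_integral => //.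
- by move=> w _; rewrite lee_fin ramp_ge0.
- exact: measurable_ramp.
- exact/measurable_EFinP/measurable_indic.
- move=> w _; rewrite lee_fin indicE; have [_|/negP hw] := boolP (w \in _); first exact: ramp_le1.
  rewrite /= ge_min; apply/orP; right; rewrite ge_max lexx/=.
  have : ~ (a < h w) by move=> ahw; apply: hw; exact/mem_set.
  by move=> /negP; rewrite -leNgt subr_le0 ler_pdivrMr// mul1r.
Qed.

(** The events [n < h] decrease to the empty set, so continuity from above applies. *)
Lemma tail_small (eta : R) : 0 < eta -> exists2 A : R, 0 < A & (P [set w | (A < h w)%R] < eta%:E)%E.
Proof.
move=> eta0; pose F (n : nat) := [set w | n%:R < h w].
have F0 : \bigcap_n F n = set0.
  rewrite -subset0 => w Fw; have := Fw (Num.truncn (h w)).+1 Logic.I.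
  by rewrite /F/= => /lt_trans/(_ (truncnS_gt (h w))); rewrite ltxx.
have mF n : measurable (F n) by exact: measurable_gt.
have := @nonincreasing_cvg_mu _ _ _ P F; rewrite F0 measure0.
have /[swap]/[apply] : (P (F 0%N) < +oo)%E by rewrite (le_lt_trans (probability_le1 _ _))// ltry.
move=> /(_ mF measurable0) cF.
have /cF{}cF : {homo F : n m / (n <= m)%N >-> (m <= n)%O}.
  move=> n k nk; apply/subsetPset => w /=; apply: le_lt_trans.
  by rewrite ler_nat.
have /cF[N _ h'] : nbhs (0%E : \bar R) [set y | (y < eta%:E)%E].
  exact: open_ereal_lt'.
exists N.+1%:R => //; exact: (h' N.+1 (leqnSn N)).
Qed.

End RampIntegral.

Section WeakLimits.
Context (R : realType) (disp : measure_display) (T : measurableType disp).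
Context (P : probability T R) (d : nat).
Context (Z : nat -> T -> 'rV[R]_d.+1) (mu : probability (borel_vec R d.+1) R).
Context (mZ : forall n, measurable_fun setT (fun w => `|Z n w 0 0| : R)).
Context (cZ : cvg_in_law P Z mu).

Let coord (y : 'rV[R]_d.+1) : R := `|y 0 0|.

Let continuous_coord : continuous coord.
Proof. by move=> y; apply: (continuous_comp (f := fun M : 'rV[R]_d.+1 => M 0 0) (g := Num.norm)); [exact: coord_continuous|exact: norm_continuous]. Qed.

Let measurable_coord : measurable_fun setT (coord : borel_vec R d.+1 -> R).
Proof.
apply: (measurability _ (RGenOpens.measurableE R)).
move=> _ [_ [a [b ->] <-]]; rewrite setTI; apply: sub_sigma_algebra.
by move/continuousP : continuous_coord; apply; exact: interval_open.
Qed.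

Let cvg_ramp a : (fun n => \int[P]_w (ramp a (coord (Z n w)))%:E)%E @ \oo -->
  (\int[mu]_y (ramp a (coord y))%:E)%E.
Proof.
apply: (cZ (f := fun y => ramp a (coord y))).
  by move=> y; apply: continuous_comp; [exact: continuous_coord|exact: continuous_ramp].
exists 1; split => // M M1 y _ /=.
by rewrite ger0_norm ?ramp_ge0// (le_trans (ramp_le1 _ _))// ltW.
Qed.

(** The tail of [Z n] beyond [2 * A] is at most the integral of [ramp A], which converges to an
    integral against [mu] bounded by the tail of [mu] beyond [A]. *)
Lemma eventually_tight eta : 0 < eta -> exists2 A : R, 0 < A &
  exists n0, forall n, (n0 <= n)%N -> (P [set w | (A < `|Z n w 0 0|)%R] <= eta%:E)%E.
Proof.
move=> eta0; have [A A0 hA] := tail_small mu measurable_coord eta0.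
exists (2 * A); first by rewrite mulr_gt0.
have h := le_lt_trans (ramp_integral_le mu measurable_coord A0) hA.
have /cvg_ramp[n0 _ hn] := open_ereal_lt' h.
exists n0 => n /hn/= /ltW; apply: le_trans.
exact: (ramp_integral_ge P (mZ n) A0).
Qed.

Context (nondeg : mu [set y : 'rV[R]_d.+1 | y 0 0 = 0] != 1%E).

(** Since the first coordinate is not almost surely 0 under [mu], some [ramp] has a positive
    integral [t] against [mu]; its integrals along [Z n] eventually exceed [t / 2]. *)
Lemma eventually_spread : exists2 del : R, 0 < del &
  exists n0, forall n, (n0 <= n)%N -> (del%:E <= P [set w | (del < `|Z n w 0 0|)%R])%E.
Proof.
have mB := measurable_gt measurable_coord.
have [k hk] : exists k : nat, (0 < mu [set y | (2 * k.+1%:R^-1 < coord y)%R])%E.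
  apply: contrapT => /forallNP h; move/eqP: nondeg; apply.
  pose B k := [set y : borel_vec R d.+1 | 2 * k.+1%:R^-1 < coord y].
  have -> : [set y : 'rV[R]_d.+1 | y 0 0 = 0] = ~` (\bigcup_k B k).
    apply/seteqP; split => y /=.
      by move=> y0 [k _]; rewrite /B/= /coord y0 normr0 ltNge mulr_ge0.
    move=> h'; apply/eqP; rewrite -normr_eq0; apply: contrapT => /negP y0.
    have {}y0 : 0 < coord y by rewrite lt_neqAle eq_sym y0 normr_ge0.
    apply: h'; exists (Num.truncn (2 / coord y)) => //.
    rewrite /B/= ltr_pdivrMr// mulrC -ltr_pdivrMr//; exact: truncnS_gt.
  have mBk k : measurable (B k) by exact: mB.
  have mU : measurable (\bigcup_k B k) by exact: bigcupT_measurable.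
  rewrite probability_setC//.
  suff -> : mu (\bigcup_k B k) = 0%E by rewrite sube0.
  apply/negligibleP => //; apply: negligible_bigcup => k; apply/negligibleP => //.
  by apply/eqP; have /negP := h k; rewrite lt_def measure_ge0 andbT negbK.
pose a : R := k.+1%:R^-1; have a0 : 0 < a by rewrite invr_gt0.
have h := lt_le_trans hk (ramp_integral_ge mu measurable_coord a0).
have Ifin : (\int[mu]_y (ramp a (coord y))%:E)%E \is a fin_num.
  rewrite ge0_fin_numE ?(ltW h)//.
  apply: le_lt_trans (ramp_integral_le mu measurable_coord a0) _.
  by rewrite (le_lt_trans (probability_le1 _ (mB a)))// ltry.
move: h (@cvg_ramp a); rewrite -(fineK Ifin); set t := fine _ => t0 ct.
have t2 : ((t / 2)%:E < t%:E)%E by rewrite lte_fin; move: t0; rewrite lte_fin; lra.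
have /ct[n0 _ hn] := open_ereal_gt' t2.
exists (Num.min a (t / 2)).
  by rewrite lt_min a0 divr_gt0.
exists n0 => n /hn/= /ltW h.
apply: (@le_trans _ _ (t / 2)%:E); first by rewrite lee_fin ge_min lexx orbT.
apply: (le_trans h); apply: (le_trans (ramp_integral_le P (mZ n) a0)).
apply: le_measure; rewrite ?inE; [exact: measurable_gt|exact: measurable_gt|].
by move=> w /=; apply: le_lt_trans; rewrite ge_min lexx.
Qed.

End WeakLimits.

(** * The first coordinate of the walk *)


(** The hyperplane of vectors with vanishing first coordinate is the row space of the kernel matrix
    of that coordinate, of rank one less than the dimension. *)
Lemma nondegenerate_coord (R : realType) (d : nat)
    (mu : probability (borel_vec R d.+1) R) :
  nondegenerate_law mu -> mu [set y : 'rV[R]_d.+1 | y 0 0 = 0] != 1%E.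
Proof.
move=> /(_ 0 (kermx (delta_mx 0 0 : 'cV[R]_d.+1))).
rewrite mxrank_ker mxrank_delta subSS subn0 => /(_ (ltnSn _)).
rewrite (_ : [set y | _] = [set y : 'rV[R]_d.+1 | y 0 0 = 0])//.
have dE (y : 'rV[R]_d.+1) : (y *m (delta_mx 0 0 : 'cV_d.+1)) 0 0 = y 0 0.
  rewrite mxE (bigD1 ord0)//= mxE !eqxx mulr1 big1 ?addr0// => i i0.
  by rewrite mxE (negPf i0) mulr0.
apply/seteqP; split => y /=; rewrite subr0.
  by move=> /sub_kermxP yd; rewrite -dE yd mxE.
by move=> y0; apply/sub_kermxP/matrixP => i j; rewrite !ord1 dE y0 mxE.
Qed.

Section FirstCoordinate.
Context (R : realType) (disp : measure_display) (T : measurableType disp).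
Context (P : probability T R) (d : nat) (X : nat -> T -> 'rV[int]_d.+1).
Context (iidX : iid P X).

Definition coord0 (n : nat) (w : T) : int := X n w 0 0.

Let pre (A : set int) : set 'rV[int]_d.+1 := [set x | A (x 0 0)].

Lemma coord0_measurable n (A : set int) : measurable (coord0 n @^-1` A).
Proof. by have [mX _ _] := iidX; exact: (mX n (pre A)). Qed.

Lemma coord0_indep (J : seq nat) (A : nat -> set int) : uniq J ->
  P (\bigcap_(j in [set` J]) (coord0 j @^-1` A j)) =
  (\prod_(j <- J) P (coord0 j @^-1` A j))%E.
Proof. by have [_ iX _] := iidX => uJ; exact: (iX J (fun j => pre (A j)) uJ). Qed.

Lemma coord0_ident n (A : set int) : P (coord0 n @^-1` A) = P (coord0 0 @^-1` A).
Proof. by have [_ _ eX] := iidX; exact: (eX n (pre A)). Qed.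

Let Pth := path_of coord0.
Let m := path_law P coord0.

Lemma coord0_walk_law : walk_law m.
Proof.
by apply: path_law_walk_law;
  [exact: coord0_measurable|exact: coord0_indep|exact: coord0_ident].
Qed.

Lemma psum_coord0 n w : psum R (path_of coord0 w) n = (walk X n w 0 0)%:~R.
Proof. by rewrite /psum /walk summxE. Qed.

Lemma path_lawE n G : cylinder n G -> (m G)%:E = P (Pth @^-1` G).
Proof.
move=> cG; rewrite fineK// fin_num_measure//.
exact: (measurable_cylinder coord0_measurable cG).
Qed.

Lemma measurable_psum_norm n : measurable_fun setT (fun w => `|psum R (Pth w) n|).
Proof.
move=> _ A _; rewrite setTI.
have cA : cylinder n [set y | A `|psum R y n|] by exact: (@cylinder_psum _ _ _ (fun s => A `|s|)).
exact: (measurable_cylinder coord0_measurable cA).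
Qed.

Lemma coord0_tail t eta : 0 < eta -> exists A, m [set y | A < `|psum R y t|] <= eta.
Proof.
move=> eta0; have [A _ hA] := tail_small P (measurable_psum_norm t) eta0.
exists A; rewrite -lee_fin (path_lawE (@cylinder_psum _ _ _ (fun s => A < `|s|) (leqnn t))).
exact: ltW.
Qed.

Lemma domain_confinement alpha eps : normal_domain_of_attraction P X alpha ->
  (1 < alpha /\ mean_vec P (X 0%N) = 0) \/ alpha < 1 -> 0 < eps ->
  exists2 p, 0 < p &
  forall N : nat, exists2 n, (N <= n)%N & exists2 x : R, N%:R <= `|x| &
  p <= m [set y | forall j, (n <= 4 * j)%N /\ (j <= n)%N ->
    `|psum R y j - x| <= eps * `|x|].
Proof.
move=> [mu [_ nondeg doa]] cases eps0; pose b : R := alpha^-1.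
pose Z n w : 'rV[R]_d.+1 := (n%:R `^ b)^-1 *: embed R (walk X n w).
(* Both cases give the same uncentred limit theorem: for [alpha > 1] the centring vanishes with the
   mean. *)
have [alpha0 alpha1 cZ] : [/\ 0 < alpha, alpha != 1 & cvg_in_law P Z mu].
  case: doa => [[/andP[a0 a1] cZ]|[/andP[a1 _] _ cZ]].
    by split => //; rewrite lt_eqF.
  case: cases => [[_ mean0]|a1']; last by have := lt_trans a1 a1'; rewrite ltxx.
  split; rewrite ?gt_eqF// ?(lt_trans ltr01)//.
  move: cZ; rewrite mean0; congr cvg_in_law.
  by apply/funext => n; apply/funext => w; rewrite scaler0 subr0.
have b0 : 0 < b by rewrite invr_gt0.
have b1 : b != 1 by rewrite -invr1 (inj_eq invr_inj).
have r1 n : (0 < n)%N -> 1 <= n%:R `^ b :> R.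
  move=> n0; have : 1 `^ b <= n%:R `^ b :> R; last by rewrite powR1.
  by apply: ge0_ler_powR; rewrite ?nnegrE ?ler1n ?(ltW b0).
have mS := measurable_psum_norm.
have ZE n w : `|Z n w 0 0| = (n%:R `^ b)^-1 * `|psum R (Pth w) n|.
  by rewrite !mxE normrM ger0_norm ?invr_ge0 ?powR_ge0// psum_coord0.
have mZ n : measurable_fun setT (fun w => `|Z n w 0 0|).
  under eq_fun do rewrite ZE.
  by apply: measurable_funM => //.
have Zgt n A : (0 < n)%N ->
    [set w | A < `|Z n w 0 0|] = [set w | A * n%:R `^ b < `|psum R (Pth w) n|].
  move=> n0; apply/seteqP; have r0 := lt_le_trans ltr01 (r1 _ n0).
  by split => w /=; rewrite ZE [_^-1 * _]mulrC ltr_pdivlMr.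
have cgt n A : cylinder n [set y | A * n%:R `^ b < `|psum R y n|].
  exact: (@cylinder_psum _ _ _ (fun s => A * n%:R `^ b < `|s|)).
apply: (confinement coord0_walk_law b0 _ _ b1 eps0).
- move=> eta eta0; have [A A0 [n0 hA]] := eventually_tight mZ cZ eta0.
  (* The limit only controls large times; the finitely many earlier ones get a common bound, which
     remains valid after scaling because [n^b >= 1] for [n > 0]. *)
  have [B B0 hB] : exists2 B, 0 < B & forall n, (n < n0)%N ->
      (P [set w | (B < `|psum R (Pth w) n|)%R] <= eta%:E)%E.
    elim: n0 {hA} => [|n [B B0 hB]]; first by exists 1.
    have [C C0 hC] := tail_small P (mS n) eta0.
    exists (Num.max B C) => [|k]; first by rewrite lt_max B0.
    rewrite ltnS leq_eqVlt => /predU1P[->|kn].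
      apply: le_trans (ltW hC); apply: le_measure; rewrite ?inE; try exact: measurable_gt.
      by move=> w /=; apply: le_lt_trans; rewrite le_max lexx orbT.
    apply: le_trans (hB _ kn); apply: le_measure; rewrite ?inE; try exact: measurable_gt.
    by move=> w /=; apply: le_lt_trans; rewrite le_max lexx.
  exists (Num.max A B) => [|n]; first by rewrite lt_max A0.
  case: n => [|n].
    rewrite (_ : [set y | _] = set0) ?(law_set0 coord0_walk_law) ?ltW//.
    rewrite -subset0 => y /=; rewrite psum0 normr0 ltNge mulr_ge0 ?powR_ge0//.
    by rewrite le_max ltW.
  rewrite -lee_fin (path_lawE (cgt _ _)).
  have [nn0|n0n] := ltnP n.+1 n0.
    apply: le_trans (hB _ nn0); apply: le_measure; rewrite ?inE.
    + exact: (measurable_cylinder coord0_measurable (cgt _ _)).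
    + exact: measurable_gt.
    + move=> w /=; apply: le_lt_trans.
      rewrite (@le_trans _ _ (Num.max A B))// ?le_max ?lexx ?orbT//.
      by rewrite ler_peMr ?r1// le_max ltW.
  apply: le_trans (hA _ n0n); rewrite Zgt//; apply: le_measure; rewrite ?inE.
  + exact: (measurable_cylinder coord0_measurable (cgt _ _)).
  + exact: (measurable_cylinder coord0_measurable (cgt _ _)).
  + by move=> w /=; apply: le_lt_trans; rewrite ler_wpM2r ?powR_ge0// le_max lexx.
- have [del del0 [n0 hdel]] := eventually_spread mZ cZ (nondegenerate_coord nondeg).
  exists del => //; exists n0.+1 => n n0n.
  rewrite -lee_fin (path_lawE (cgt _ _)).
  by have := hdel n (ltnW n0n); rewrite Zgt// (leq_ltn_trans _ n0n).
Qed.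

End FirstCoordinate.

(** * Sets of macroscopic density zero *)


Section CountingIntegers.
Context (R : realType).
Implicit Types (B : {fset int}) (a b x rho : R).

Lemma card_int_ball_le B x rho : 0 <= rho ->
  (forall z, z \in B -> `|z%:~R - x| <= rho) -> #|` B|%:R <= 2 * rho + 1.
Proof.
move=> rho0 Brho; pose c := Num.ceil (x - rho).
have cP : x - rho <= c%:~R by exact: ceil_ge.
have rho2 : 0 <= 2 * rho by rewrite mulr_ge0.
pose n := (Num.truncn (2 * rho)).+1.
have sB : {subset (B : seq int) <= [seq c + i%:Z | i <- iota 0 n]}.
  move=> z zB; have := Brho z zB; rewrite ler_norml => /andP[z1 z2].
  have cz : c <= z by rewrite ceil_le_int; lra.
  have zn : (`|z - c| < n)%N.
    have zE : (`|z - c|%N%:R : R) = z%:~R - c%:~R.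
      by rewrite -[_%:R]/((`|z - c|%N : int)%:~R) gez0_abs ?subr_ge0// rmorphB.
    rewrite -(ltr_nat R) zE; have /truncn_itv/andP[_] := rho2.
    by apply: le_lt_trans; lra.
  apply/mapP; exists `|z - c|%N; first by rewrite mem_iota.
  have zc0 : 0 <= z - c by rewrite subr_ge0.
  by rewrite (gez0_abs zc0) [RHS]addrC subrK.
have := uniq_leq_size (fset_uniq B) sB; rewrite size_map size_iota -(ler_nat R).
move/le_trans; apply; rewrite /n -natr1 lerD2r.
by have /truncn_itv/andP[] := rho2.
Qed.

Lemma card_int_itv_ge B a b : a < b ->
  (forall z : int, a <= z%:~R <= b -> z \in B) -> b - a - 1 <= #|` B|%:R.
Proof.
move=> ab abB; pose n := Num.truncn (b - a).
have ba0 : 0 <= b - a by lra.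
have /truncn_itv/andP[n1 n2] := ba0.
have /andP[c1 c2] := ceil_itv a; rewrite rmorphB/= in c1.
have sB : {subset [seq Num.ceil a + i%:Z | i <- iota 0 n] <= (B : seq int)}.
  move=> _ /mapP[i + ->]; rewrite mem_iota => /= i_n; apply: abB.
  have iR : i.+1%:R <= n%:R :> R by rewrite ler_nat.
  rewrite rmorphD/= -[(_%:Z)%:~R]/(i%:R); rewrite -natr1 in iR.
  have i0 : 0 <= i%:R :> R by [].
  by apply/andP; split; lra.
have un : uniq [seq Num.ceil a + i%:Z | i <- iota 0 n].
  by rewrite map_inj_uniq ?iota_uniq// => i j /addrI [].
have := uniq_leq_size un sB; rewrite size_map size_iota -(ler_nat R); apply: le_trans.
by move: n2; rewrite -natr1 -/n; lra.
Qed.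

End CountingIntegers.

Section ThinSets.
Context (R : realType) (d : nat) (D : set int).

(** The interval about 0 is meant for all clusters small compared with [r], and the one about [x]
    for the only cluster of order [r]. *)
Definition thin := forall theta : R, 0 < theta -> exists r0 : R, forall r, r0 <= r ->
  exists x : R, forall z, D z -> `|z%:~R| <= r ->
    `|z%:~R| <= theta * r \/ `|z%:~R - x| <= theta * r.

Let F (x : 'rV[int]_d.+1) : R := `[< D (x 0 0) >]%:R.

Let side (a b : 'I_d.+1 -> R) := [set z : int | a 0 <= z%:~R <= b 0].

Let finite_side a b : finite_set (side a b).
Proof.
pose c : 'I_1 -> R := fun=> a 0; pose c' : 'I_1 -> R := fun=> b 0.
apply: sub_finite_set (finite_image (fun x : 'rV[int]_1 => x 0 0) (finite_box c c')).
by move=> z zab; exists (\row_j z); rewrite ?mxE// => j; rewrite mxE.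
Qed.

(* The map (x, z) |-> (x with coordinate 0 replaced by z, x 0 0) embeds
   (points of the box in D) x (side) into (box) x (points of the side in D). *)
Let average_le (a b : 'I_d.+1 -> R) : average F (box a b) <=
  #|` [fset z in fset_set (side a b) | `[< D z >]]%fset|%:R / #|` fset_set (side a b)|%:R.
Proof.
set A := fset_set (box a b); set B := fset_set (side a b).
have AP x : (x \in A) = `[< box a b x >].
  by rewrite in_fset_set ?inE//; exact: finite_box.
have BP z : (z \in B) = `[< side a b z >] by rewrite in_fset_set ?inE.
pose A' := [fset x in A | `[< D (x 0 0) >]]%fset.
set B' := [fset z in B | _]%fset.
have A'P x : (x \in A') = (x \in A) && `[< D (x 0 0) >] by rewrite !inE.
have B'P z : (z \in B') = (z \in B) && `[< D z >] by rewrite !inE.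
have -> : average F (box a b) = #|` A'|%:R / #|` A|%:R.
  rewrite /average fsbig_finite/=; last exact: finite_box.
  rewrite mulrC -/A; congr (_ / _).
  rewrite card_fset_sum1 natr_sum -big_fset_condE/= [RHS]big_mkcond/=.
  by apply: eq_bigr => x _; rewrite /F; case: asboolP.
pose phi (xz : 'rV[int]_d.+1 * int) : 'rV[int]_d.+1 * int :=
  (\row_j if j == 0 then xz.2 else xz.1 0 j, xz.1 0 0).
have phiK : cancel phi phi.
  move=> [x z]; rewrite /phi/=; congr (_, _); last by rewrite mxE.
  by apply/rowP => j; rewrite !mxE/=; case: eqP => [->|].
have card_le : (#|` A'| * #|` B| <= #|` A| * #|` B'|)%N.
  rewrite -(size_allpairs (fun x z => phi (x, z))) -(size_allpairs pair).
  apply: uniq_leq_size.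
    by rewrite allpairs_uniq ?fset_uniq// => -[x z] [x' z'] _ _ /= /(can_inj phiK).
  move=> _ /allpairsP[[x z] /= [xA' zB ->]].
  have : x \in A' by exact: xA'.
  rewrite A'P AP => /andP[/asboolP xab Dx].
  have : z \in B by exact: zB.
  rewrite BP => /asboolP zab.
  have p1A : (phi (x, z)).1 \in A.
    rewrite AP; apply/asboolP => j.
    by rewrite mxE; case: eqP => [->|_]; [exact: zab|exact: xab].
  have p2B : (phi (x, z)).2 \in B'.
    by rewrite B'P BP Dx andbT; apply/asboolP; exact: xab.
  by apply/allpairsP; exists (phi (x, z)); split => //; rewrite -surjective_pairing.
have [A0|A0] := posnP #|` A|; first by rewrite A0 invr0 mulr0 divr_ge0.
have B0 : (0 < #|` B|)%N.
  rewrite cardfs_gt0; move: A0; rewrite cardfs_gt0 => /fset0Pn[x].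
  rewrite AP => /asboolP xab; apply/fset0Pn; exists (x 0 0).
  by rewrite BP; apply/asboolP; exact: xab.
rewrite ler_pdivrMr ?ltr0n// mulrAC ler_pdivlMr ?ltr0n//.
by rewrite -!natrM ler_nat [leqRHS]mulnC.
Qed.

(** The limit is 0. The average over a box is at most the density of [D] in its first side, and two
    short intervals cover [D] there. *)
Lemma thin_G0 : thin -> G0 F.
Proof.
move=> thinD; split.
  exists 1; split => // M M1 x _ /=; rewrite ger0_norm ?ler0n// (le_trans _ (ltW M1))//.
  by rewrite /F; case: asboolP.
exists 0 => a b ab; apply/cvgr0Pnorm_le => e e0.
pose c := Num.max `|a 0| `|b 0|; pose l := b 0 - a 0.
have l0 : 0 < l by rewrite subr_gt0.
have c0 : 0 < c.
  rewrite lt_max !normr_gt0 -negb_and; apply/negP => /andP[/eqP a0 /eqP b0].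
  by have := ab 0; rewrite a0 b0 ltxx.
(* With [theta * c = e * l / 8], the two intervals hold at most [e l L / 2 + 2] points, to be
   compared with [e (l L - 1)]; this leads to the condition [4 + 2 e <= e l L]. *)
pose theta := e * l / (8 * c).
have theta0 : 0 < theta by rewrite divr_gt0 ?mulr_gt0.
have [r0 hr0] := thinD theta theta0.
near=> L.
have L0 : 0 < L by near: L; apply: nbhs_pinfty_gt; exact: num_real.
have Lr : r0 <= c * L.
  by rewrite mulrC -ler_pdivrMr//; near: L; apply: nbhs_pinfty_ge; exact: num_real.
have Le : (4 + 2 * e) / (e * l) <= L by near: L; apply: nbhs_pinfty_ge; exact: num_real.
have Ll : 2 / l <= L by near: L; apply: nbhs_pinfty_ge; exact: num_real.
set V := box _ _.
have avg0 : 0 <= average F V.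
  rewrite /average mulr_ge0 ?invr_ge0// fsumr_ge0// => x _; exact: ler0n.
rewrite ger0_norm//; apply: (le_trans (average_le _ _)).
set B := fset_set _; set B' := [fset z in B | _]%fset.
have BP z : (z \in B) = (a 0 * L <= z%:~R <= b 0 * L).
  by rewrite in_fset_set//; apply/idP/idP => [/set_mem|h]//; exact/mem_set.
have B'P z : (z \in B') = (z \in B) && `[< D z >] by rewrite !inE.
have B_ge : l * L - 1 <= #|` B|%:R.
  rewrite /l mulrBl; apply: card_int_itv_ge; first by rewrite ltr_pM2r.
  by move=> z; rewrite BP.
have [x hx] := hr0 _ Lr.
have B'_le : #|` B'|%:R <= 2 * (2 * (theta * (c * L)) + 1).
  pose B1 := [fset z in B' | `|z%:~R| <= theta * (c * L)]%fset.
  pose B2 := [fset z in B' | `|z%:~R - x| <= theta * (c * L)]%fset.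
  have B1P z : (z \in B1) = (z \in B') && (`|z%:~R| <= theta * (c * L)).
    by rewrite !inE.
  have B2P z : (z \in B2) = (z \in B') && (`|z%:~R - x| <= theta * (c * L)).
    by rewrite !inE.
  have tcL : 0 <= theta * (c * L) := mulr_ge0 (ltW theta0) (mulr_ge0 (ltW c0) (ltW L0)).
  have : (#|` B'| <= #|` B1| + #|` B2|)%N.
    have sB : (B' `<=` B1 `|` B2)%fset.
      apply/fsubsetP => z zB'; rewrite in_fsetU B1P B2P zB'/=.
      move: zB'; rewrite B'P BP => /andP[/andP[z1 z2] /asboolP Dz].
      have zc : `|z%:~R| <= c * L.
        have aL : - (`|a 0| * L) <= a 0 * L by rewrite -mulNr ler_pM2r// lerNl -normrN ler_norm.
        have bL : b 0 * L <= `|b 0| * L by rewrite ler_pM2r// ler_norm.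
        have acL : `|a 0| * L <= c * L by rewrite ler_pM2r// le_max lexx.
        have bcL : `|b 0| * L <= c * L by rewrite ler_pM2r// le_max lexx orbT.
        by rewrite ler_norml; apply/andP; split; lra.
      by apply/orP; exact: hx.
    by apply: leq_trans (fsubset_leq_card sB) _; rewrite cardfsU leq_subr.
  rewrite -(ler_nat R) natrD => /le_trans; apply.
  have : #|` B1|%:R <= 2 * (theta * (c * L)) + 1.
    apply: (@card_int_ball_le _ _ 0 _ tcL) => u.
    by rewrite B1P subr0 => /andP[].
  have : #|` B2|%:R <= 2 * (theta * (c * L)) + 1.
    by apply: (@card_int_ball_le _ _ x _ tcL) => u; rewrite B2P => /andP[].
  lra.
have tE : theta * (c * L) = e * (l * L) / 8 by rewrite /theta; field; rewrite gt_eqF.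
have {}Le : 4 + 2 * e <= e * (l * L).
  by move: Le; rewrite ler_pdivrMr ?mulr_gt0//; lra.
have {}Ll : 2 <= l * L by move: Ll; rewrite ler_pdivrMr// mulrC.
have B0 : 0 < #|` B|%:R :> R by lra.
rewrite ler_pdivrMr//; apply: (le_trans B'_le); rewrite tE.
by have := ler_wpM2l (ltW e0) B_ge; lra.
Unshelve. all: by end_near. Qed.

End ThinSets.

(** * Stages *)


(** The index moves up only when the next value of [q] is at least the current harmonic term, so
    [q (h i)] keeps a divergent sum; each move is eventually allowed because the harmonic terms tend
    to 0. *)
Lemma slow_index (R : realType) (q : nat -> R) : (forall j, 0 < q j) ->
  exists h : nat -> nat,
    (forall M, exists I, forall i, (I <= i)%N -> (M <= h i)%N) /\
    (exists I, forall i, (I <= i)%N -> i.+1%:R^-1 <= q (h i)).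
Proof.
move=> q0.
pose fix h i := if i is i'.+1 then
  if i'.+2%:R^-1 <= q (h i').+1 then (h i').+1 else h i' else 0%N.
have inv_small (c : R) : 0 < c -> exists I, forall i, (I <= i)%N -> i.+1%:R^-1 <= c.
  move=> c0; exists (Num.truncn c^-1) => i ci.
  rewrite -[leRHS]invrK lef_pV2 ?posrE ?invr_gt0//.
  by rewrite (le_trans (ltW (truncnS_gt _)))// ler_nat ltnS.
have h_mono i j : (i <= j)%N -> (h i <= h j)%N.
  elim: j => [|j ih]; first by rewrite leqn0 => /eqP ->.
  rewrite leq_eqVlt => /predU1P[->//|/ih /leq_trans]; apply => /=.
  by case: ifP.
have h_inv i : h i = 0%N \/ i.+1%:R^-1 <= q (h i).
  elim: i => [|i ih]; first by left.
  rewrite /=; case: ifP => [|_]; first by right.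
  case: ih => [|ih]; [by left|right; apply: le_trans ih].
  by rewrite lef_pV2 ?posrE// ler_nat.
exists h; split.
  elim=> [|M [I hI]]; first by exists 0%N.
  have [J hJ] := inv_small _ (q0 M.+1).
  exists (maxn I J).+1 => i Ji; apply: leq_trans (h_mono _ _ Ji) => /=.
  have := hI _ (leq_maxl I J); rewrite leq_eqVlt => /predU1P[<-|Mh].
    by rewrite hJ// (leq_trans (leq_maxr I J)).
  by case: ifP => _ //; exact: ltnW.
have [I hI] := inv_small _ (q0 0%N).
by exists I => i Ii; have [->|//] := h_inv i; exact: hI.
Qed.

(** While [u i > eta], one step multiplies [u i - eta] by at most [1 - 1/(i+1)], so
    [(u i - eta) * i] stays bounded by [I]: divergence of the harmonic series in quantitative
    form. *)
Lemma harmonic_decay (R : realType) (u v p : nat -> R) (eta : R) (I : nat) :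
  0 < eta -> u I <= 1 ->
  (forall i, (I <= i)%N -> [/\ u i.+1 <= u i - v i * p i, 0 <= v i,
     u i - eta <= v i & i.+1%:R^-1 <= p i]) ->
  exists L, u L <= 2 * eta.
Proof.
move=> eta0 uI uS.
have claim k : (u (I + k)%N - eta) * (I + k)%:R <= I%:R.
  elim: k => [|k ih].
    by rewrite addn0 ler_piMl//; lra.
  have [u1 v0 uv ip] := uS (I + k)%N (leq_addr _ _).
  rewrite addnS; set i := (I + k)%N in ih u1 v0 uv ip *.
  have i1 : 0 < i.+1%:R :> R by [].
  have vp : v i <= v i * p i * i.+1%:R.
    by rewrite -mulrA ler_peMr// -ler_pdivrMr// mul1r.
  have I0 : 0 <= I%:R :> R by [].
  have : (u i.+1 - eta) * i.+1%:R <= (u i - eta) * i.+1%:R - v i.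
    have : (u i.+1 - eta) * i.+1%:R <= (u i - v i * p i - eta) * i.+1%:R.
      by rewrite ler_pM2r// lerD2r.
    lra.
  move: ih; rewrite -natr1 => ih.
  have [w0|w0] := leP 0 (u i - eta); first by lra.
  move=> h; apply: le_trans h _; have : 0 <= i%:R :> R by [].
  nra.
pose k := (Num.truncn (I%:R / eta)).+1.
exists (I + k)%N.
have k0 : 0 < (I + k)%:R :> R by rewrite ltr0n addnS.
have kI : I%:R <= eta * (I + k)%:R.
  rewrite mulrC -ler_pdivrMr// (le_trans (ltW (truncnS_gt _)))// ler_nat.
  exact: leq_addl.
have := le_trans (claim k) kI; rewrite ler_pM2r//; lra.
Qed.

Section Scales.
Context (R : realType) (m : set (nat -> int) -> R) (mP : walk_law m).
Local Notation S := (psum R).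

Definition confined n (x e : R) := [set y | forall j, (n <= 4 * j)%N /\ (j <= n)%N ->
  `|S y j - x| <= e * `|x|].

Lemma cylinder_confined n x e : cylinder n (confined n x e).
Proof.
apply: (@cylinder_psums _ _ (fun j => (n <= 4 * j)%N /\ (j <= n)%N)
    (fun=> fun s => `|s - x| <= e * `|x|)) => j [_]//.
Qed.

(* Stage k occupies the times t k, ..., t k + n k = t k.+1, and is successful
   when the walk spends all but the first quarter of it close to x k. *)
Record scales (e : nat -> R) (t n : nat -> nat) (x : nat -> R) : Prop := Scales {
  scale_e : forall k, 0 < e k <= 8^-1;
  scale_e0 : forall eta, 0 < eta -> exists K, forall k, (K <= k)%N -> e k <= eta;
  scale_t : forall k, t k.+1 = (t k + n k)%N;
  scale_n : forall k, (0 < n k)%N /\ (8 * t k <= n k)%N;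
  scale_x : forall k, k.+1%:R <= `|x k|;
  scale_xS : forall k, `|x k| <= e k.+1 * `|x k.+1|;
  scale_start : forall k, m [set y | e k * `|x k| < `|S y (t k)|] <= e k;
  scale_confined : exists K, forall k, (K <= k)%N ->
    (k./2).+1%:R^-1 <= m (confined (n k) (x k) (e k)) }.

Context (tail : forall t eta, 0 < eta -> exists A, m [set y | A < `|S y t|] <= eta).
Context (confinement : forall eps, 0 < eps -> exists2 p, 0 < p &
  forall N : nat, exists2 n, (N <= n)%N & exists2 x : R, N%:R <= `|x| &
  p <= m (confined n x eps)).

Lemma scales_exist : exists e t n x, scales e t n x.
Proof.
pose e0 (j : nat) : R := (j + 8)%:R^-1.
have e00 j : 0 < e0 j by rewrite invr_gt0 ltr0n addnS.
have /choice[q hq] : forall j, exists p, 0 < p /\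
    forall N : nat, exists2 n, (N <= n)%N & exists2 x : R, N%:R <= `|x| &
    p <= m (confined n x (e0 j)).
  by move=> j; have [p p0 hp] := confinement (e00 j); exists p.
have [h [hoo [I hI]]] := slow_index (fun j => (hq j).1).
(* The two stages [2 i] and [2 i + 1] share the index [h i], so each parity class separately
   inherits the harmonic lower bound. *)
pose e k := e0 (h k./2).
have stepP (ks : nat * (nat * R)) : exists nx : nat * R,
  [/\ (0 < nx.1)%N, (8 * ks.2.1 <= nx.1)%N, ks.1.+1%:R <= `|nx.2|,
     ks.2.2 <= e ks.1 * `|nx.2| &
     m [set y | e ks.1 * `|nx.2| < `|S y ks.2.1|] <= e ks.1 /\
     q (h ks.1./2) <= m (confined nx.1 nx.2 (e ks.1))].
  case: ks => k [t b] /=; have ek : 0 < e k by exact: e00.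
  have [A tA] := tail t ek.
  (* The summands secure, in turn, a stage much longer than its past, the growth of [|x|], dominance
     over the previous scale [b], and dominance over the position at time [t]. *)
  pose N := ((8 * t).+1 + k.+1 + (Num.truncn (b / e k)).+1 + (Num.truncn (A / e k)).+1)%N.
  have [n Nn [x Nx qx]] := (hq (h k./2)).2 N.
  have bound c : ((Num.truncn (c / e k)).+1 <= N)%N -> c <= e k * `|x|.
    move=> cN; rewrite mulrC -ler_pdivrMr// (le_trans (ltW (truncnS_gt _)))//.
    by rewrite (le_trans _ Nx)// ler_nat.
  exists (n, x); split => /=.
  - by apply: leq_trans Nn; rewrite /N; clear; lia.
  - by apply: leq_trans Nn; rewrite /N; clear; lia.
  - by apply: le_trans Nx; rewrite ler_nat /N; clear; lia.
  - by apply: bound; exact: leq_trans (leq_addl _ _) (leq_addr _ _).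
  - split=> //; apply: le_trans tA; apply: (law_le mP (n := t)).
    + exact: (@cylinder_psum _ _ _ (fun s => e k * `|x| < `|s|)).
    + exact: (@cylinder_psum _ _ _ (fun s => A < `|s|)).
    + by move=> y /=; apply: le_lt_trans; apply: bound; exact: leq_addl.
have [g gP] := choice stepP.
(* The state is the starting time of the stage and the previous [|x|]; the initial 1 is a
   placeholder for the latter. *)
pose fix st k : nat * R := if k is k'.+1 then
  (((st k').1 + (g (k', st k')).1)%N, `|(g (k', st k')).2|) else (0%N, 1).
pose n k := (g (k, st k)).1; pose x k := (g (k, st k)).2.
exists e, (fun k => (st k).1), n, x; split.
- by move=> k; rewrite e00/= /e /e0 lef_pV2 ?posrE ?ler_nat ?leq_addl.
- move=> eta eta0; have [J hJ] := hoo (Num.truncn eta^-1).+1.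
  exists (J.*2) => k Jk; rewrite /e /e0.
  have /hJ Jh : (J <= k./2)%N by rewrite -(doubleK J) half_leq.
  rewrite -[leRHS]invrK lef_pV2 ?posrE ?invr_gt0//.
  rewrite (le_trans (ltW (truncnS_gt _)))// ler_nat.
  by rewrite (leq_trans Jh)// leq_addr.
- by [].
- by move=> k; have [] := gP (k, st k).
- by move=> k; have [] := gP (k, st k).
- by move=> k; have [] := gP (k.+1, st k.+1).
- by move=> k; have [_ _ _ _ []] := gP (k, st k).
- exists (I.*2) => k Ik; have [_ _ _ _ [_]] := gP (k, st k); apply: le_trans.
  by apply: hI; rewrite -(doubleK I) half_leq.
Qed.

End Scales.

(** * The marked set and the successful stages *)

Section ScalesTheory.
Context (R : realType) (m : set (nat -> int) -> R) (mP : walk_law m).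
Local Notation S := (psum R).
Context (e : nat -> R) (t n : nat -> nat) (x : nat -> R) (sc : scales m e t n x).

(** The factor 2 covers the displacement at the start of the stage plus the confinement error, each
    at most [e k * |x k|]. *)
Definition near_scale k (z : int) := `|z%:~R - x k| <= 2 * e k * `|x k|.

Definition marked : set int := [set z | exists k, ~~ odd k /\ near_scale k z].

Let e_le k : e k <= 8^-1. Proof. by have /andP[] := scale_e sc k. Qed.
Let x_gt0 k : 0 < `|x k|. Proof. exact: lt_le_trans (scale_x sc k). Qed.

Let near_bounds k z : near_scale k z ->
  `|z%:~R| <= 5 / 4 * `|x k| /\ 3 / 4 * `|x k| <= `|z%:~R|.
Proof.
move=> zk; have := ler_normD (z%:~R - x k) (x k); rewrite subrK.
have := ler_normD (x k - z%:~R) z%:~R; rewrite subrK distrC.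
have : 2 * e k * `|x k| <= 1 / 4 * `|x k|.
  by rewrite ler_pM2r//; have := e_le k; lra.
by move: zk; rewrite /near_scale; lra.
Qed.

Let x_le k l : (k <= l)%N -> `|x k| <= `|x l|.
Proof.
elim: l => [|l ih]; first by rewrite leqn0 => /eqP ->.
rewrite leq_eqVlt => /predU1P[->//|/ih/le_trans]; apply.
apply: (le_trans (scale_xS sc l)); rewrite ler_piMl//.
by have := e_le l.+1; lra.
Qed.

Let x_lt k l : (k < l)%N -> `|x k| <= e l * `|x l|.
Proof. by case: l => // l kl; apply: le_trans (scale_xS sc l); exact: x_le. Qed.

(** Points near scale [k] have modulus between 3/4 and 5/4 of [|x k|], and [|x k|] is at most an
    eighth of [|x l|] for [k < l]. *)
Lemma near_scale_inj k l z : near_scale k z -> near_scale l z -> k = l.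
Proof.
wlog kl : k l / (k < l)%N.
  move=> wl zk zl; have [kl|lk|//] := ltngtP k l; first exact: wl.
  by apply/esym; exact: wl.
move=> /near_bounds[z1 _] /near_bounds[_ z2]; exfalso.
have : e l * `|x l| <= 8^-1 * `|x l| by rewrite ler_pM2r.
have := x_lt kl; have := x_gt0 l; lra.
Qed.

Lemma marked_near k z : near_scale k z -> marked z <-> ~~ odd k.
Proof.
move=> zk; split=> [[l [ol zl]]|ok]; last by exists k.
by rewrite (near_scale_inj zk zl).
Qed.

Lemma thin_marked : thin R marked.
Proof.
move=> th th0.
have [K hK] := scale_e0 sc (divr_gt0 th0 (ltr0n R 8)).
(* Beyond this radius, a point near a scale of index below [K] has modulus at most [th * r]. *)
exists (2 * `|x K| / th) => r; rewrite ler_pdivrMr// => xr.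
have r0 : 0 < r.
  have : 0 < r * th by apply: lt_le_trans xr; rewrite mulr_gt0.
  by rewrite pmulr_lgt0.
have [[z [k [zk zr zth]]]|noz] := pselect (exists z k,
    [/\ near_scale k z, `|z%:~R| <= r & th * r < `|z%:~R|]); last first.
  exists 0 => z [k [_ zk]] zr; left; rewrite leNgt; apply/negP => zth.
  by apply: noz; exists z, k.
have kK l u : near_scale l u -> th * r < `|u%:~R| -> (K <= l)%N.
  move=> /near_bounds[ul _] uth; rewrite leqNgt; apply/negP => lK.
  by have := x_le (ltnW lK); have := x_gt0 l; lra.
exists (x k) => u [l [_ ul]] ur.
have [uth|uth] := leP `|u%:~R : R| (th * r); [by left|right].
(* Two distinct scales cannot both have points of modulus in []th r, r]]: the smaller [|x a|] is at
   most [e b * |x b|], hence far below [th * r]. So the scale [k] of a single such point accounts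
   for all of them. *)
have excl a b c d : near_scale a c -> near_scale b d -> `|d%:~R| <= r ->
    th * r < `|c%:~R| -> th * r < `|d%:~R| -> ~ (a < b)%N.
  move=> ac bd dr cth dth ab.
  have eb := hK b (kK _ _ bd dth).
  have [c1 _] := near_bounds ac; have [_ d2] := near_bounds bd.
  have : e b * `|x b| <= th / 8 * `|x b| by rewrite ler_pM2r.
  have : th * `|x b| <= th * (4 / 3 * r) by rewrite ler_pM2l//; lra.
  have := x_lt ab; have := mulr_gt0 th0 r0; lra.
have lk : l = k.
  have [lk|kl|//] := ltngtP l k; exfalso.
    exact: excl ul zk zr uth zth lk.
  exact: excl zk ul ur zth uth kl.
rewrite lk in ul; have ek := hK k (kK _ _ zk zth).
have [_ z2] := near_bounds zk.
have : e k * `|x k| <= th / 8 * `|x k| by rewrite ler_pM2r.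
have : th * `|x k| <= th * (4 / 3 * r) by rewrite ler_pM2l//; lra.
have := mulr_gt0 th0 r0; move: ul; rewrite /near_scale; lra.
Qed.

Definition success k : set (nat -> int) :=
  [set y | `|S y (t k)| <= e k * `|x k|] `&`
  shift (t k) @^-1` (confined (n k) (x k) (e k)).

Let t_le k l : (k <= l)%N -> (t k <= t l)%N.
Proof.
elim: l => [|l ih]; first by rewrite leqn0 => /eqP ->.
rewrite leq_eqVlt => /predU1P[->//|/ih/leq_trans]; apply.
by rewrite (scale_t sc) leq_addr.
Qed.

Lemma cylinder_success k : cylinder (t k.+1) (success k).
Proof.
rewrite (scale_t sc); apply: cylinderI.
  exact: (@cylinder_psum _ _ _ (fun s => `|s| <= e k * `|x k|) (leq_addr _ _)).
apply: cylinder_shift; exact: cylinder_confined.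
Qed.

Definition no_success (c : bool) I L : set (nat -> int) :=
  [set y | forall i, (I <= i < L)%N -> ~ success (c + i.*2) y].

Lemma cylinder_no_success (c : bool) I L : cylinder (t (c + L.*2)) (no_success c I L).
Proof.
move=> y y' yy' ny i iL s; apply: (ny i iL).
apply: (cylinder_success (k := c + i.*2)) s => j jt; apply/esym/yy'.
apply: (leq_trans jt); apply: t_le; move: iL; clear; case: c => /=; lia.
Qed.

(** Past failures and the starting condition depend on times up to [t (k i)], and confinement on
    later increments. Hence each stage removes at least a harmonic fraction of the surviving mass,
    up to an error [eta / 2] from bad starts. *)
Lemma no_success_small c I eta : 0 < eta -> exists L, m (no_success c I L) <= eta.
Proof.
move=> eta0; have eta20 : 0 < eta / 2 by rewrite divr_gt0.
have [K1 hK1] := scale_e0 sc eta20.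
have [K2 hK2] := scale_confined sc.
pose U i := no_success c I i.
pose k i := (c + i.*2)%N.
pose H i := [set y | `|S y (t (k i))| <= e (k i) * `|x (k i)|].
pose A i := confined (n (k i)) (x (k i)) (e (k i)).
have cU i : cylinder (t (k i)) (U i) by exact: cylinder_no_success.
have cH i : cylinder (t (k i)) (H i).
  exact: (@cylinder_psum _ _ _ (fun s => `|s| <= e (k i) * `|x (k i)|)).
suff rec i : (maxn I (maxn K1 K2) <= i)%N -> [/\
    m (U i.+1) <= m (U i) - m (U i `&` H i) * m (A i), 0 <= m (U i `&` H i),
    m (U i) - eta / 2 <= m (U i `&` H i) & i.+1%:R^-1 <= m (A i)].
  have [L hL] := @harmonic_decay _ (fun i => m (U i)) (fun i => m (U i `&` H i))
    (fun i => m (A i)) _ _ eta20 (law_le1 mP (cU _)) rec.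
  by exists L; move: hL; rewrite mulrC divfK.
rewrite !geq_max => /and3P[Ii K1i K2i].
have ki : (i <= k i)%N by rewrite /k; clear; lia.
split; last 1 first.
- have := hK2 (k i) (leq_trans K2i ki); rewrite /k.
  by rewrite half_bit_double.
- have cUS : cylinder (t (k i).+1) (U i) by apply: cylinder_le (cU i); exact: t_le.
  rewrite (law_split mP cUS (@cylinder_success (k i))).
  rewrite -(law_markov mP (cylinderI (cU i) (cH i)) (@cylinder_confined _ _ _ _)).
  rewrite (_ : U i `&` success (k i) = U i `&` H i `&` shift (t (k i)) @^-1` A i); last first.
    by rewrite setIA.
  rewrite [X in X - _]addrC addrK; apply: (law_le mP (cU i.+1)).
    apply: cylinder_le (cylinderI cUS (cylinderC (@cylinder_success (k i)))).
    by apply: t_le; rewrite /k; clear; lia.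
  move=> y Uy; split; first by move=> j /andP[Ij ji]; apply: Uy; rewrite Ij ltnW.
  by apply: Uy; rewrite Ii ltnSn.
- exact: law_ge0.
- have := law_split mP (cU i) (cH i).
  have : m (U i `&` ~` H i) <= m (~` H i).
    apply: (law_le mP (n := t (k i))) => [| |y []//].
      by apply: cylinderI => //; exact: cylinderC.
    exact: cylinderC.
  have -> : ~` H i = [set y | e (k i) * `|x (k i)| < `|S y (t (k i))|].
    by apply/seteqP; split => y /=; rewrite ltNge => /negP.
  have := scale_start sc (k i); have := hK1 (k i) (leq_trans K1i ki); lra.
Qed.

End ScalesTheory.

(** * Divergence of the averages *)


Section AverageAtScales.
Context (R : realType) (m : set (nat -> int) -> R).
Context (e : nat -> R) (t n : nat -> nat) (x : nat -> R) (sc : scales m e t n x).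
Context (g : nat -> R) (y : nat -> int).
Context (gE : forall i, g i = `[< marked e x (\sum_(j < i) y j) >]%:R).

Let T_ N : R := \sum_(1 <= i < N.+1) g i.

Let g01 i : 0 <= g i <= 1.
Proof. by rewrite gE; case: asboolP => _; rewrite ?lexx ler01. Qed.

Lemma success_marked k j : success e t n x k y ->
  (n k <= 4 * j)%N -> (j <= n k)%N -> g (t k + j)%N = (~~ odd k)%:R.
Proof.
move=> [/= s0 s1] j1 j2; have := s1 j (conj j1 j2); rewrite psum_shift => s2.
rewrite gE; congr (nat_of_bool _)%:R.
have zk : near_scale e x k (\sum_(i < t k + j) y i).
  rewrite /near_scale -/(psum R y (t k + j)).
  have := ler_normD (psum R y (t k + j) - psum R y (t k) - x k) (psum R y (t k)).
  by rewrite addrAC subrK; lra.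
by apply/asboolP/idP => /(marked_near sc zk).
Qed.

Let split_T k : let q := (n k %/ 4)%N in
  T_ (t k.+1) = \sum_(1 <= i < (t k + q).+1) g i +
    \sum_((t k + q).+1 <= i < (t k.+1).+1) g i.
Proof.
move=> q; rewrite /T_ (@big_cat_nat _ _ _ (t k + q).+1)//=.
by rewrite (scale_t sc) ltnS leq_add2l leq_div.
Qed.

Let late_sum k : success e t n x k y -> let q := (n k %/ 4)%N in
  \sum_((t k + q).+1 <= i < (t k.+1).+1) g i = (n k - q)%:R * (~~ odd k)%:R.
Proof.
move=> sk q.
rewrite (eq_big_nat _ _ (F2 := fun=> (~~ odd k)%:R)) => [|i /andP[i1 i2]].
  by rewrite sumr_const_nat (scale_t sc) subSS subnDl mulr_natl.
have ti : (t k <= i)%N by apply: leq_trans (leq_trans (leqnSn _) i1); rewrite leq_addr.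
rewrite -(subnKC ti); apply: success_marked => //.
  have qi : (q < i - t k)%N by rewrite ltn_subRL.
  apply: ltnW; apply: leq_trans (ltn_ceil (n k) (isT : (0 < 4)%N)) _.
  by rewrite mulnC leq_pmul2l.
by rewrite leq_subLR -(scale_t sc) -ltnS.
Qed.

Let scale_bounds k : [/\ 0 < (n k)%:R :> R, 8 * (t k)%:R <= (n k)%:R :> R,
  (t k.+1)%:R = (t k)%:R + (n k)%:R :> R & 4 * (n k %/ 4)%:R <= (n k)%:R :> R].
Proof.
have [n0 tn] := scale_n sc k; split; first by rewrite ltr0n.
- by rewrite -natrM ler_nat.
- by rewrite (scale_t sc) natrD.
- by rewrite -natrM ler_nat mulnC leq_divM.
Qed.

(** At least three quarters of the stage is marked, and [t k <= n k / 8], so the ratio is at least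
    [(3/4) / (9/8) = 2/3]. *)
Lemma average_even k : ~~ odd k -> success e t n x k y ->
  2 / 3 <= T_ (t k.+1) / (t k.+1)%:R.
Proof.
move=> ok sk; rewrite split_T (late_sum sk) ok mulr1.
have [n0 tn tS qn] := scale_bounds k.
have s0 : 0 <= \sum_(1 <= i < (t k + n k %/ 4).+1) g i.
  by apply: sumr_ge0 => i _; have /andP[] := g01 i.
have t0 : 0 <= (t k)%:R :> R by [].
have tS0 : 0 < (t k.+1)%:R :> R by rewrite tS; lra.
rewrite ler_pdivlMr// tS.
by rewrite natrB ?leq_div//; lra.
Qed.

(** Marked times lie in the past or in the first quarter of the stage, at most [n k / 8 + n k / 4]
    in number. *)
Lemma average_odd k : odd k -> success e t n x k y ->
  T_ (t k.+1) / (t k.+1)%:R <= 3 / 8.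
Proof.
move=> ok sk; rewrite split_T (late_sum sk) ok mulr0 addr0.
have [n0 tn tS qn] := scale_bounds k.
have s1 : \sum_(1 <= i < (t k + n k %/ 4).+1) g i <= (t k)%:R + (n k %/ 4)%:R.
  apply: (@le_trans _ _ (\sum_(1 <= i < (t k + n k %/ 4).+1) 1)).
    by apply: ler_sum => i _; have /andP[] := g01 i.
  by rewrite sumr_const_nat subn1/= natrD.
have t0 : 0 <= (t k)%:R :> R by [].
have tS0 : 0 < (t k.+1)%:R :> R by rewrite tS; lra.
by rewrite ler_pdivrMr// tS; lra.
Qed.

Lemma scale_time_ge k : (k <= t k.+1)%N.
Proof.
elim: k => // k ih; rewrite (scale_t sc); have [n0 _] := scale_n sc k.+1.
by apply: leq_ltn_trans ih _; rewrite -[X in (X < _)%N]addn0 ltn_add2l.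
Qed.

Lemma average_not_cvg :
  (forall (c : bool) I, exists i, (I <= i)%N /\ success e t n x (c + i.*2) y) ->
  ~ cvgn (fun N => T_ N / N%:R).
Proof.
(* A limit would be within 1/8 of values at least 2/3 and of values at most 3/8, whose gap 7/24
   exceeds 1/4. *)
move=> io /cvg_ex[l /cvgrPdist_lt/(_ 8^-1)]; rewrite invr_gt0 => /(_ (ltr0n _ 8)).
move=> [I _ hI].
have [i [Ii si]] := io false I; have [j [Ij sj]] := io true I.
have big (c : bool) u : (I <= u)%N -> (I <= t (c + u.*2).+1)%N.
  move=> Iu; apply: leq_trans (scale_time_ge _).
  by rewrite (leq_trans Iu)// -addnn addnA leq_addl.
have := hI _ (big false i Ii); have := hI _ (big true j Ij).
have := average_even _ si; rewrite oddD odd_double => /(_ isT).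
have := average_odd _ sj; rewrite oddD odd_double => /(_ isT).
rewrite /= !ltr_norml => h1 h2 /andP[h3 h4] /andP[h5 h6].
lra.
Qed.

End AverageAtScales.

Theorem theorem1p9 (R : realType) (disp : measure_display)
    (T : measurableType disp) (P : probability T R)
    (d : nat) (X : nat -> T -> 'rV[int]_d) (alpha : R) :
  (1 <= d)%N ->
  iid P X ->
  nondegenerate_walk P X ->
  aperiodic_walk P X ->
  normal_domain_of_attraction P X alpha ->
  (1 < alpha /\ mean_vec P (X 0%N) = 0) \/ alpha < 1 ->
  exists F : 'rV[int]_d -> R, G0 F /\
    {ae P, forall w, ~ cvgn (fun N => additive_functional X F N w / N%:R)}.
Proof.
case: d X => // d X _ iidX _ _ doa cases.
have [e [t [n [x sc]]]] := scales_exist (coord0_walk_law iidX) (coord0_tail iidX)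
  (fun eps => domain_confinement iidX (eps := eps) doa cases).
exists (fun z : 'rV[int]_d.+1 => `[< marked e x (z 0 0) >]%:R); split.
  exact: thin_G0 (thin_marked sc).
(* No success from index [I] on, in the even stages for [c = false] and in the odd ones for
   [c = true]. *)
pose N (c : bool) I := [set w | forall i, (I <= i)%N ->
  ~ success e t n x (c + i.*2) (path_of (coord0 X) w)].
have N0 c I : P.-negligible (N c I).
  have NE : N c I = \bigcap_L (path_of (coord0 X) @^-1` no_success e t n x c I L).
    apply/seteqP; split => w /=.
      by move=> Nw L _ i /andP[Ii _]; exact: Nw.
    by move=> Nw i Ii; apply: (Nw i.+1 Logic.I); rewrite Ii ltnSn.
  have cNS L := @cylinder_no_success _ _ _ _ _ _ sc c I L.
  have mNL L := measurable_cylinder (coord0_measurable iidX) (cNS L).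
  have mN : measurable (N c I) by rewrite NE; exact: bigcapT_measurable.
  (* The event lies in [no_success] up to [L] for every [L], and these have arbitrarily small
     probability. *)
  apply/negligibleP => //; apply/eqP; rewrite -measure_le0; apply/lee_addgt0Pr => eta eta0.
  rewrite add0e; have [L hL] := no_success_small (coord0_walk_law iidX) sc c I eta0.
  apply: le_trans (_ : (path_law P (coord0 X) (no_success e t n x c I L))%:E <= _)%E; last first.
    by rewrite lee_fin.
  rewrite (path_lawE iidX (cNS L)).
  by apply: le_measure; rewrite ?inE//; rewrite NE; exact: bigcap_inf.
have bad0 : P.-negligible (\bigcup_I (N false I `|` N true I)).
  by apply: negligible_bigcup => I; exact: negligibleU.
apply: negligibleS bad0.
  move=> w /= /contrapT cw; apply: contrapT => nN.
  (* Outside the null set, both parity classes succeed infinitely often. *)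
  have io (c : bool) I : exists i, (I <= i)%N /\
      success e t n x (c + i.*2) (path_of (coord0 X) w).
    apply: contrapT => /forallNP h; apply: nN; exists I => //.
    have Nc : N c I w by move=> i Ii s; exact: (h i).
    by case: c Nc {h}; [right|left].
  have gE i : `[< marked e x (walk X i w 0 0) >]%:R =
      `[< marked e x (\sum_(j < i) path_of (coord0 X) w j) >]%:R :> R.
    by rewrite /walk summxE.
  exact: (average_not_cvg sc gE io).
Qed.
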